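(* Let $U\subset\mathbb R^d$ be open and $\mathbf f:U\to\mathbb R^n$ continuous and good. The following are equivalent: (i) the set $\{\mathbf x\in U:\mathbf f(\mathbf x)\text{ is not VWMA}\}$ is dense in $U$; (ii) $\mathbf f$ is strongly extremal; (iii) for a.e. $\mathbf x_0\in U$ and every $r>0$ there is a ball $B\subset U$ centered at $\mathbf x_0$ of radius less than $r$ satisfying condition ( ** ); (iv) every ball $B\subset U$ satisfies ( ** ). Here condition ( ** ) for a ball $B$ is: for every $\beta>0$ there exists $T>0$ such that for every $\mathbf t\in\mathbb R^n_{\ge0}$ with $t\ge T$ and every $\Gamma\in\mathcal S_{n+1}$, $\sup_{\mathbf x\in B}\|g_{\mathbf t}u_{\mathbf f(\mathbf x)}\Gamma\|\ge e^{-\beta t}$.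
   Context: A function $f:V\to\mathbb R$ is $(C,\alpha)$-good on $V$ if for every open ball $B\subset V$ and $\varepsilon>0$, $|\{\mathbf x\in B:|f(\mathbf x)|<\varepsilon\sup_B|f|\}|\le C\varepsilon^\alpha|B|$. $\mathbf f=(f_1,\dots,f_n)$ is good at $\mathbf x_0$ if there are a neighborhood $V$ of $\mathbf x_0$ and $C,\alpha>0$ such that every linear combination of $1,f_1,\dots,f_n$ is $(C,\alpha)$-good on $V$; $\mathbf f$ is good if good at a.e. point. $\Pi_+(\mathbf x)=\prod\max(|x_i|,1)$; $\mathbf y\in\mathbb R^n$ is VWMA if for some $v>n$ there are infinitely many $\mathbf q\in\mathbb Z^n$ with $|\mathbf y\mathbf q+p|\le\Pi_+(\mathbf q)^{-v/n}$, $p\in\mathbb Z$; $\mathbf f$ is strongly extremal if $\mathbf f(\mathbf x)$ is not VWMA for a.e. $\mathbf x$. For $\mathbf t\in\mathbb R^n_{\ge0}$, $t=\sum t_i$, $g_{\mathbf t}=\mathrm{diag}(e^t,e^{-t_1},\dots,e^{-t_n})$; $u_{\mathbf y}=\begin{pmatrix}1&\mathbf y\\0&I_n\end{pmatrix}$. With $\mathbf e_I$ the wedge of standard basis vectors $\mathbf e_i$, $i\in I\subset\{0,\dots,n\}$ (increasing), $\|\sum w_I\mathbf e_I\|=\max|w_I|$; $\mathcal S_{n+1}$ is the set of nonzero subgroups of $\mathbb Z^{n+1}$ of rank $\le n$, and for $\Gamma$ with basis $\mathbf v_1,\dots,\mathbf v_j$, $\|g\Gamma\|=\|g\mathbf v_1\wedge\dots\wedge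 g\mathbf v_j\|$. *)

(* Defs.v *)
From HB Require Import structures.
From mathcomp Require Import all_boot all_order all_algebra.
From mathcomp Require Import all_classical all_reals all_analysis.
Set Implicit Arguments. Unset Strict Implicit. Unset Printing Implicit Defensive.
Import Order.TTheory GRing.Theory Num.Theory.
Import numFieldNormedType.Exports.
Local Open Scope classical_set_scope.
Local Open Scope ring_scope.

Section Defs.
Variable R : realType.

Definition box (d : nat) (a b : 'rV[R]_d) : set 'rV[R]_d :=
  [set x | forall i, a 0 i <= x 0 i /\ x 0 i <= b 0 i].

Definition box_vol (d : nat) (a b : 'rV[R]_d) : R :=
  \prod_(i < d) Num.max (b 0 i - a 0 i) 0.

Definition lebo (d : nat) (A : set 'rV[R]_d) : \bar R :=
  ereal_inf [set s : \bar R | exists a b : nat -> 'rV[R]_d,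
    A `<=` \bigcup_k box (a k) (b k) /\
    s = (\sum_(0 <= k <oo) ((box_vol (a k) (b k))%:E))%E].

Definition ae_in (d : nat) (U : set 'rV[R]_d) (P : 'rV[R]_d -> Prop) : Prop :=
  lebo [set x | U x /\ ~ P x] = 0%E.

Definition eball (d : nat) (c : 'rV[R]_d) (r : R) : set 'rV[R]_d :=
  [set x | Num.sqrt (\sum_(i < d) (x 0 i - c 0 i) ^+ 2) < r].

Definition CA_good (d : nat) (C alpha : R) (V : set 'rV[R]_d)
  (h : 'rV[R]_d -> R) : Prop :=
  forall (c : 'rV[R]_d) (r : R), 0 < r -> eball c r `<=` V ->
  forall eps : R, 0 < eps ->
    (lebo [set x | eball c r x /\
       (`|h x|%:E < eps%:E * ereal_sup [set `|h y|%:E | y in eball c r])%E]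
     <= (C * eps `^ alpha)%:E * lebo (eball c r))%E.

Definition good_at (d n : nat) (U : set 'rV[R]_d) (f : 'rV[R]_d -> 'rV[R]_n)
  (x0 : 'rV[R]_d) : Prop :=
  exists V : set 'rV[R]_d, nbhs x0 V /\ V `<=` U /\
  exists C alpha : R, 0 < C /\ 0 < alpha /\
  forall (c0 : R) (c : 'rV[R]_n),
    CA_good C alpha V (fun x => c0 + \sum_(i < n) c 0 i * f x 0 i).

Definition good (d n : nat) (U : set 'rV[R]_d) (f : 'rV[R]_d -> 'rV[R]_n) :=
  ae_in U (good_at U f).

Definition Pi_plus (n : nat) (q : 'rV[int]_n) : R :=
  \prod_(i < n) Num.max `|(q 0 i)%:~R : R| 1.

Definition VWMA (n : nat) (y : 'rV[R]_n) : Prop :=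
  exists v : R, n%:R < v /\
   ~ finite_set [set q : 'rV[int]_n | exists p : int,
        `|\sum_(i < n) y 0 i * (q 0 i)%:~R + p%:~R|
          <= Pi_plus q `^ (- (v / n%:R))].

Definition strongly_extremal (d n : nat) (U : set 'rV[R]_d)
  (f : 'rV[R]_d -> 'rV[R]_n) : Prop :=
  ae_in U (fun x => ~ VWMA (f x)).

Definition tsum (n : nat) (t : 'rV[R]_n) : R := \sum_(i < n) t 0 i.

Definition g_t (n : nat) (t : 'rV[R]_n) : 'M[R]_(1 + n) :=
  block_mx (expR (tsum t))%:M 0 0 (diag_mx (map_mx (fun s => expR (- s)) t)).

Definition u_y (n : nat) (y : 'rV[R]_n) : 'M[R]_(1 + n) :=
  block_mx 1%:M y 0 1%:M.

(* norm of the wedge of the columns of M: max of |j x j minors| over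
   increasing row selections I = (s 0 < ... < s (j-1)) *)
Definition wedge_norm (m j : nat) (M : 'M[R]_(m, j)) : R :=
  \big[Num.max/0]_(s : {ffun 'I_j -> 'I_m} |
       [forall i : 'I_j, forall k : 'I_j, (i < k)%N ==> (s i < s k)%N])
     `|\det (rowsub s M)|.

(* Gamma in S_{n+1} is given by a basis: the columns of V : 'M[int]_(n+1, j),
   linearly independent, with 1 <= j <= n; ||g Gamma|| = wedge_norm (g V). *)
Definition lattice_basis (n j : nat) (V : 'M[int]_(n.+1, j)) : Prop :=
  (0 < j <= n)%N /\ \rank (map_mx (fun z : int => z%:~R : R) V) = j.

Definition cond_ss (d n : nat) (f : 'rV[R]_d -> 'rV[R]_n) (B : set 'rV[R]_d)
  : Prop :=
  forall beta : R, 0 < beta -> exists T : R, 0 < T /\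
  forall t : 'rV[R]_n, (forall i, 0 <= t 0 i) -> T <= tsum t ->
  forall (j : nat) (V : 'M[int]_(n.+1, j)), lattice_basis V ->
    ((expR (- (beta * tsum t)))%:E <=
      ereal_sup [set (wedge_norm (g_t t *m u_y (f x) *m
                        map_mx (fun z : int => z%:~R : R) V))%:E | x in B])%E.

End Defs.

(* Main.v *)
(* (iii) => (ii) is quantitative nondivergence. The coordinates of
   g_t u_f(x) Gamma are linear combinations of 1, f_1, ..., f_n, so the norms
   x |-> ||g_t u_f(x) Gamma|| are uniformly good. If g_t u_f(x) Z^(n+1) has a
   vector much shorter than rho, then any flag of lattices whose norms at x lie
   in [eps, 1] can be enlarged by a lattice of norm less than rho. Induction on the length of the flag, with a stopping time on
   dyadic cubes in place of a covering theorem, shows that such x have measure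
   O((eps / rho)^alpha); Borel-Cantelli over integral t and Dani's correspondence
   conclude. (i) => (iv): if the covolume condition fails on a ball, Hermite's
   inequality produces, for every x of the ball, vectors of g_t u_f(x) Z^(n+1)
   of size exp(- gamma t) for unboundedly large t, so f(x) is VWMA throughout the
   ball. (ii) => (i) holds because balls have positive outer measure. *)
Require Import Defs.
From HB Require Import structures.
From mathcomp Require Import all_boot all_order all_algebra.
From mathcomp Require Import all_classical all_reals all_analysis.
From mathcomp Require Import perm.
From mathcomp Require Import ring lra zify.
Import Order.TTheory GRing.Theory Num.Theory.
Import numFieldNormedType.Exports.
Set Implicit Arguments. Unset Strict Implicit. Unset Printing Implicit Defensive.
Local Open Scope classical_set_scope.
Local Open Scope ring_scope.

(** * The outer measure [lebo] *)

(** No set of points with short vectors is shown to be measurable: the argument lives on the outer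
    measure [lebo], and countable subadditivity is all that it uses. This shapes the stopping
    argument. The formal volumes of the dyadic pieces of a cube add up to that of the cube by plain
    arithmetic, so a local bound proportional to them can be summed without any additivity of
    [lebo]. The price is a constant passage between cubes, which subdivide well, and Euclidean
    balls, on which goodness is phrased.

    Three levels have to be kept apart. Members of a flag have norm between [eps] and 1, while every
    lattice must reach [rho] somewhere on the ball. Goodness then bounds the set where a newly added
    lattice falls below [eps]. With levels exponential in t the cost (eps / rho)^alpha decays
    exponentially, which beats the polynomial number of integral t of a given sum.

    A lattice produced by the flag argument could have the same span as a member of the flag and yet
    a smaller norm. Restricting flags to lattices of minimal covolume in their span excludes
    this. *)

Section outer_measure.
Context {R : realType} {d : nat}.
Local Notation E := 'rV[R]_d.+1.
Implicit Types (a b : E) (A B : set E).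

Lemma box_vol_ge0 (a b : E) : 0 <= box_vol a b.
Proof. by apply: prodr_ge0 => i _; rewrite le_max lexx orbT. Qed.

Lemma lebo_ge0 A : (0 <= lebo A)%E.
Proof.
apply: le_ereal_inf_tmp => _ [a [b [_ ->]]].
by apply: nneseries_ge0 => k _ _; rewrite lee_fin box_vol_ge0.
Qed.

Lemma le_lebo A B : A `<=` B -> (lebo A <= lebo B)%E.
Proof.
move=> AB; apply: ereal_inf_le_tmp => s [a [b [Bab ->]]].
by exists a, b; split => //; exact: subset_trans Bab.
Qed.

(** In dimension 0 the empty product gives every box volume 1, and [lebo] is infinite even on the
    empty set; hence the dimension [d.+1] throughout. *)
Lemma box_vol_diag (a : E) : box_vol a a = 0.
Proof. by rewrite /box_vol big_ord_recl subrr maxxx mul0r. Qed.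

Lemma lebo_box_le (a b : E) : (lebo (box a b) <= (box_vol a b)%:E)%E.
Proof.
apply: ereal_inf_lbound; exists (fun k => if k is 0%N then a else 0 : E).
exists (fun k => if k is 0%N then b else 0 : E); split.
  by move=> x abx; exists 0%N.
rewrite nneseries_recl//; last by move=> k _; rewrite lee_fin box_vol_ge0.
rewrite eseries_cond/= eseries0 ?adde0// => -[|]//= k _ _.
by rewrite box_vol_diag.
Qed.

Lemma lebo_set0 : lebo (set0 : set E) = 0%E.
Proof.
apply/eqP; rewrite eq_le lebo_ge0 andbT.
have := lebo_box_le 0 0; rewrite box_vol_diag; apply: le_trans.
exact: le_lebo.
Qed.

Lemma lebo_sigma_subadditive : sigma_subadditive (@lebo R d.+1).
Proof.
move=> A; have [[i ioo]|] := pselect (exists i, lebo (A i) = +oo%E).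
  rewrite (eseries_pinfty _ _ ioo) ?leey// => k _.
  by rewrite -ltNye (lt_le_trans _ (lebo_ge0 _)).
rewrite -forallNE => Aoo; apply/lee_addgt0Pr => e e0.
apply: le_trans (epsilon_trick _ _ (ltW e0)); last first.
  by move=> k; exact: lebo_ge0.
have coverA k : exists ab : (nat -> E) * (nat -> E),
    A k `<=` \bigcup_i box (ab.1 i) (ab.2 i) /\
    (\sum_(0 <= i <oo) (box_vol (ab.1 i) (ab.2 i))%:E <=
       lebo (A k) + (e / (2 ^ k.+1)%:R)%:E)%E.
  have fk : lebo (A k) \is a fin_num.
    by rewrite ge0_fin_numE ?lebo_ge0// ltey; apply/eqP/Aoo.
  have ek : 0 < e / (2 ^ k.+1)%:R by rewrite divr_gt0// ltr0n expn_gt0.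
  have [_ [a [b [Aab ->]]] /ltW ?] := lb_ereal_inf_adherent ek fk.
  by exists (a, b).
have {coverA}[ab abA] := choice coverA.
pose v (p : nat * nat) := ((box_vol ((ab p.1).1 p.2) ((ab p.1).2 p.2))%:E)%E.
have v0 p : (0 <= v p)%E by rewrite lee_fin box_vol_ge0.
apply: (@le_trans _ _ (\esum_(p in [set: nat * nat]) v p)).
  have /card_esym/ppcard_eqP[h] := card_nat2.
  apply: ereal_inf_lbound.
  exists (fun k => (ab (h k).1).1 (h k).2), (fun k => (ab (h k).1).2 (h k).2).
  split.
    move=> x [k _ /(abA k).1 [i _ abx]]; exists (h^-1%FUN (k, i)) => //=.
    by rewrite invK ?inE.
  rewrite (reindex_esum [set: nat] [set: nat * nat] h) => //.
  by rewrite nneseries_esumT// => k; exact: v0 (h k).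
rewrite (_ : [set: nat * nat] = [set: nat] `*`` (fun=> [set: nat])); last first.
  by apply/seteqP; split.
rewrite -(@esum_esum _ _ _ _ _ (fun i j => v (i, j)))//.
rewrite nneseries_esumT; last first.
  move=> k; apply: adde_ge0; first exact: lebo_ge0.
  by rewrite lee_fin divr_ge0// ltW.
apply: le_esum => k _; apply: le_trans (abA k).2.
by rewrite nneseries_esumT// => i; exact: v0 (k, i).
Qed.

HB.instance Definition _ := isOuterMeasure.Build R E (@lebo R d.+1)
  lebo_set0 lebo_ge0 le_lebo lebo_sigma_subadditive.

Lemma lebo_bigcup_fin (I : finType) (A : I -> set E) :
  (lebo (\bigcup_i A i) <= \sum_i lebo (A i))%E.
Proof.
have -> : \bigcup_i A i = \big[setU/set0]_(i : I) A i.
  by rewrite -bigcup_seq; apply/seteqP; split => x [i _ Aix]; exists i;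
    rewrite //= mem_index_enum.
elim/big_rec2: _ => [|i M B _ ih]; first by rewrite lebo_set0.
by apply: le_trans (outer_measureU2 _ _ _) _; rewrite leeD2l.
Qed.

Lemma lebo_null_bigcup_count (I : countType) (A : I -> set E) :
  (forall i, lebo (A i) = 0%E) -> lebo (\bigcup_i A i) = 0%E.
Proof.
move=> A0; apply/eqP; rewrite eq_le lebo_ge0 andbT.
pose B k := if unpickle k is Some i then A i else set0.
apply: (@le_trans _ _ (lebo (\bigcup_k B k))).
  by apply: le_lebo => x [i _ Aix]; exists (pickle i) => //; rewrite /B pickleK.
apply: le_trans (lebo_sigma_subadditive _) _.
rewrite eseries0// => k _ _; rewrite /B; case: (unpickle k) => [i|]; first exact: A0.
exact: lebo_set0.
Qed.

End outer_measure.

(** * Stopping times on dyadic cubes *)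

Lemma exists_half_lt (R : realType) (s e : R) : 0 < s -> 0 < e ->
  exists m, s / 2 ^+ m < e.
Proof.
move=> s0 e0; exists (Num.bound (s / e)).
rewrite ltr_pdivrMr ?exprn_gt0// mulrC -ltr_pdivrMr//.
apply: lt_le_trans (archi_boundP _) _; first by rewrite divr_ge0 ?ltW.
by rewrite -natrX ler_nat ltnW// ltn_expl.
Qed.

Section cubes.
Context {R : realType} {d : nat}.
Local Notation E := 'rV[R]_d.+1.
Implicit Types (a b c x : E) (s r : R) (A : set E).

Definition cube a s : set E := [set x | forall i, a 0 i <= x 0 i < a 0 i + s].

Definition subcorner a s (e : {ffun 'I_d.+1 -> bool}) : E :=
  \row_i (a 0 i + (s / 2) * (e i)%:R).

Lemma cube_subcorners a s : cube a s `<=` \bigcup_e cube (subcorner a s e) (s / 2).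
Proof.
move=> x ax; exists [ffun i => a 0 i + s / 2 <= x 0 i] => // i.
have := ax i; rewrite /subcorner mxE ffunE.
case: (leP (a 0 i + s / 2)) => /= h /andP[h1 h2].
  by rewrite mulr1; apply/andP; split; lra.
by rewrite mulr0; apply/andP; split; lra.
Qed.

Lemma subcorner_cube a s e : cube (subcorner a s e) (s / 2) `<=` cube a s.
Proof.
move=> x ax i; have := ax i; rewrite /subcorner mxE.
case: (e i) => /= /andP[h1 h2]; apply/andP; split; lra.
Qed.

Lemma lebo_cube_le a s : 0 <= s -> (lebo (cube a s) <= (s ^+ d.+1)%:E)%E.
Proof.
move=> s0; apply: (@le_trans _ _ (lebo (box a (a + const_mx s)))).
  apply: le_lebo => x ax i; have /andP[h1 h2] := ax i.
  by rewrite !mxE; split => //; exact: ltW.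
apply: le_trans (lebo_box_le _ _) _; rewrite lee_fin /box_vol.
rewrite (eq_bigr (fun=> s)); last first.
  by move=> i _; rewrite !mxE addrAC subrr add0r; apply/max_idPl.
by rewrite prodr_const card_ord.
Qed.

Lemma eball_coord c r x i : eball c r x -> `|x 0 i - c 0 i| < r.
Proof.
rewrite /eball /=; apply: le_lt_trans; rewrite -sqrtr_sqr ler_wsqrtr//.
by rewrite (bigD1 i)//= lerDl sumr_ge0// => j _; exact: sqr_ge0.
Qed.

(** The crude factor d + 1, instead of its square root, keeps the constants integral. It is the
    origin of the factor [D] in [dilation] and of the bases [4 * D] and [2 * D] in
    [nondiv_const]. *)
Lemma eball_sup c r x : (forall i, `|x 0 i - c 0 i| < r) ->
  eball c (d.+1%:R * r) x.
Proof.
move=> xc; have r0 : 0 < r by exact: le_lt_trans (xc 0).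
rewrite /eball /=; apply: (@lt_le_trans _ _ (Num.sqrt (d.+1%:R * r ^+ 2))).
  rewrite ltr_sqrt; last by rewrite mulr_gt0// exprn_gt0.
  rewrite mulr_natl -[d.+1 in X in _ < X]card_ord -sumr_const.
  apply: ltr_sum; first by apply/hasP; exists 0; rewrite // mem_index_enum.
  move=> i _; rewrite -[ltLHS]real_normK ?num_real// ltr_pXn2r ?nnegrE//; exact: ltW.
have dr0 : 0 <= d.+1%:R * r by rewrite mulr_ge0// ltW.
rewrite -(ger0_norm dr0) -sqrtr_sqr ler_wsqrtr//.
rewrite exprMn ler_wpM2r ?sqr_ge0// -natrX ler_nat.
by rewrite expnS leq_pmulr.
Qed.

Lemma nbhs_coord x A : nbhs x A -> exists2 r : R, 0 < r &
  forall y : E, (forall i, `|y 0 i - x 0 i| < r) -> A y.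
Proof.
move=> /nbhs_ballP[r /= r0 rA]; exists r => // y yx; apply: rA; split => // i j.
by rewrite ord1 /ball /= distrC.
Qed.

Lemma nbhs_eball c r : 0 < r -> nbhs c (eball c r).
Proof.
move=> r0; apply/nbhs_ballP; exists (r / d.+1%:R) => /= [|x [_ cx]].
  by rewrite divr_gt0.
have -> : r = d.+1%:R * (r / d.+1%:R) by field.
by apply: eball_sup => i; have := cx 0 i; rewrite /ball /= distrC.
Qed.

Lemma eball_center c r : 0 < r -> eball c r c.
Proof.
move=> r0; rewrite /eball /= big1 ?sqrtr0// => i _.
by rewrite subrr expr0n.
Qed.

Lemma lebo_eball_le c r : 0 < r -> (lebo (eball c r) <= ((2 * r) ^+ d.+1)%:E)%E.
Proof.
move=> r0; apply: le_trans (lebo_cube_le (c - const_mx r) _); last lra.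
apply: le_lebo => x cx i; have := eball_coord i cx.
by rewrite !mxE ltr_norml => /andP[h1 h2]; apply/andP; split; lra.
Qed.

Section stopping.
Variables (P : E -> R -> Prop) (A : set E).

(* The points of [A] in the cube [(a, s)] for which the first cube satisfying
   [P] along the chain of dyadic subcubes containing them has depth [k]. *)
Fixpoint stopped k a s : set E :=
  if pselect (P a s) then (if k is 0%N then A `&` cube a s else set0)
  else if k is k'.+1 then
    \bigcup_e stopped k' (subcorner a s e) (s / 2)
  else set0.

Lemma stopped_exists k a s x : cube a s x -> A x ->
  (forall a', cube a' (s / 2 ^+ k) x -> P a' (s / 2 ^+ k)) ->
  exists2 j, (j <= k)%N & stopped j a s x.
Proof.
elim: k a s => [|k ih] a s ax Ax hP.
  exists 0%N => //=; case: pselect => //; rewrite expr0 divr1 in hP.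
  by move=> /= nP; exfalso; exact/nP/hP.
case: (pselect (P a s)) => Pas; first by exists 0%N => //=; case: pselect.
have [e _ ex] := cube_subcorners ax.
case: (ih _ _ ex Ax).
  by move=> a'; rewrite -mulrA -invfM -exprS; exact: hP.
by move=> j jk xj; exists j.+1 => //=; case: pselect => //= _; exists e.
Qed.

Variables (I : E -> R -> Prop) (M : R).
Hypothesis I_subcorner : forall a s e, I a s -> I (subcorner a s e) (s / 2).
Hypothesis I_ge0 : forall a s, I a s -> 0 <= s.
Hypothesis lebo_first : forall a s e, I a s -> ~ P a s ->
  P (subcorner a s e) (s / 2) ->
  (lebo (A `&` cube (subcorner a s e) (s / 2)) <= (M * (s / 2) ^+ d.+1)%:E)%E.
Hypothesis M0 : 0 <= M.

(** The 2^(d+1) halves have formal volumes adding up to that of the cube, so the bound passes from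
    the halves to the cube with the same [M]. A half satisfying [P] contributes at depth 0 only, and
    its parent fails [P], as [lebo_first] requires. *)
Lemma sum_stopped_le K a s : I a s -> ~ P a s ->
  (\sum_(k < K) lebo (stopped k a s) <= (M * s ^+ d.+1)%:E)%E.
Proof.
elim: K a s => [|K ih] a s Ias Pas.
  by rewrite big_ord0 lee_fin mulr_ge0// exprn_ge0// (I_ge0 Ias).
rewrite big_ord_recl /=; case: pselect => //= _; rewrite lebo_set0 add0e.
apply: (@le_trans _ _
    (\sum_(k < K) \sum_e lebo (stopped k (subcorner a s e) (s / 2)))).
  by apply: lee_sum => k _; exact: lebo_bigcup_fin.
rewrite exchange_big /=.
apply: (@le_trans _ _ (\sum_(e : {ffun 'I_d.+1 -> bool})
    (M * (s / 2) ^+ d.+1)%:E)).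
  apply: lee_sum => e _; case: (pselect (P (subcorner a s e) (s / 2))) => Pe.
    case: K {ih} => [|K].
      by rewrite big_ord0 lee_fin mulr_ge0// exprn_ge0// (I_ge0 (I_subcorner e Ias)).
    rewrite big_ord_recl big1 ?adde0.
      by rewrite /=; case: pselect => //= _; exact: lebo_first.
    by move=> i _; rewrite /=; case: pselect => //= _; rewrite lebo_set0.
  by apply: ih => //; exact: I_subcorner.
rewrite sumEFin lee_fin sumr_const card_ffun card_bool card_ord.
by rewrite -[leLHS]mulr_natr natrX -mulrA -exprMn divfK.
Qed.

Lemma lebo_stopping a s : I a s -> ~ P a s ->
  (forall x, A x -> exists k, forall a',
     cube a' (s / 2 ^+ k) x -> P a' (s / 2 ^+ k)) ->
  (lebo (A `&` cube a s) <= (M * s ^+ d.+1)%:E)%E.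
Proof.
move=> Ias Pas stop.
apply: (@le_trans _ _ (lebo (\bigcup_k stopped k a s))).
  apply: le_lebo => x [Ax ax]; have [k /(stopped_exists ax Ax)[j _ xj]] := stop _ Ax.
  by exists j.
apply: le_trans (lebo_sigma_subadditive _) _.
apply: lime_le; first by apply: is_cvg_nneseries => k _ _; exact: lebo_ge0.
by near=> K; rewrite big_mkord; exact: sum_stopped_le.
Unshelve. all: by end_near. Qed.

End stopping.
End cubes.

(** * Balls have positive outer measure *)

Section lower_bound.
Context {R : realType} {d : nat}.
Local Notation E := 'rV[R]_d.+1.
Implicit Types (a b c x p q : E) (s r : R) (A : set E).

(** The volume of the intersection of [box p q] with the cube of corner [a] and side [s]. *)
Definition overlap p q a s : R :=
  \prod_i Num.max (Num.min (q 0 i) (a 0 i + s) - Num.max (p 0 i) (a 0 i)) 0.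

Lemma overlap_ge0 p q a s : 0 <= overlap p q a s.
Proof. by apply: prodr_ge0 => i _; rewrite le_max lexx orbT. Qed.

Lemma overlap_le p q a s : overlap p q a s <= box_vol p q.
Proof.
apply: ler_prod => i _; rewrite le_max lexx orbT /=.
rewrite ge_max [X in _ && X]le_max lexx orbT andbT le_max; apply/orP; left.
by apply: lerB; rewrite ?ge_min ?le_max lexx.
Qed.

Lemma max_min_split (u v w m z : R) : w <= m -> m <= z -> u <= v ->
  Num.max (Num.min v z - Num.max u m) 0 + Num.max (Num.min v m - Num.max u w) 0 =
  Num.max (Num.min v z - Num.max u w) 0.
Proof.
move=> wm mz uv; have [vm|mv] := leP v m.
  rewrite (min_l (le_trans vm mz)) [X in X + _]max_r ?add0r//.
  by rewrite subr_le0 le_max vm orbT.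
have [mu|um] := leP m u.
  rewrite (max_l (le_trans wm mu)) [X in _ + X]max_r ?addr0//.
  by rewrite subr_le0.
have h1 : m <= Num.min v z by rewrite le_min (ltW mv).
have h2 : Num.max u w <= m by rewrite ge_max (ltW um).
by move: (Num.min v z) (Num.max u w) h1 h2 => A B h1 h2; rewrite !max_l; lra.
Qed.

Lemma overlap_split p q a s : 0 <= s ->
  (forall i, p 0 i <= q 0 i) ->
  \sum_e overlap p q (subcorner a s e) (s / 2) = overlap p q a s.
Proof.
move=> s0 pq; rewrite /overlap.
pose F i (b : bool) := Num.max (Num.min (q 0 i) (a 0 i + s / 2 * b%:R + s / 2)
  - Num.max (p 0 i) (a 0 i + s / 2 * b%:R)) 0.
rewrite (eq_bigr (fun e : {ffun 'I_d.+1 -> bool} => \prod_i F i (e i))); last first.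
  by move=> e _; apply: eq_bigr => i _; rewrite /subcorner mxE.
rewrite -bigA_distr_bigA; apply: eq_bigr => i _.
rewrite big_bool /F /= mulr1 mulr0 addr0 -addrA -splitr.
by apply: max_min_split; rewrite ?pq//; lra.
Qed.

(** Continuity at 0 of the polynomial in y with factors l_i + 2 y. It serves to put the closed boxes
    of a cover inside open ones at little cost. *)
Lemma box_vol_enlarge p q (e : R) : 0 < e -> exists dl : R, 0 < dl /\
  box_vol (p - const_mx dl) (q + const_mx dl) <= box_vol p q + e.
Proof.
move=> e0; pose l i : R := Num.max (q 0 i - p 0 i) 0.
pose P : {poly R} := \prod_i ((l i)%:P + 2%:P * 'X).
have PE y : P.[y] = \prod_i (l i + 2 * y).
  by rewrite horner_prod; apply: eq_bigr => i _; rewrite !hornerE.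
have := @continuous_horner R P 0.
move/cvgrPdist_lt => /(_ e e0) /nbhs_ballP[dl /= dl0 h].
have dl2 : 0 < dl / 2 by rewrite divr_gt0.
exists (dl / 2); split => //.
have /h : ball 0 dl (dl / 2).
  by rewrite /ball /= sub0r normrN gtr0_norm//; lra.
rewrite /= ltr_distlC !PE => /andP[_ /ltW hh].
apply: (@le_trans _ _ (\prod_i (l i + 2 * (dl / 2)))).
  apply: ler_prod => i _; rewrite !mxE le_max lexx orbT /=.
  rewrite /l /Num.max; do ! case: ifPn; rewrite -?leNgt => *; lra.
apply: le_trans hh _; rewrite lerD2r; apply: ler_prod => i _.
by rewrite mulr0 addr0 le_max lexx orbT /=.
Qed.

(** * Bisection of a cube that is covered in proportion less than 1 *)

Section bisection.
Variables (p q : nat -> E).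
Hypothesis pq : forall k i, p k 0 i <= q k 0 i.

Let small a s := (\sum_(0 <= k <oo) (overlap (p k) (q k) a s)%:E < (s ^+ d.+1)%:E)%E.

Lemma small_subcorner a s : 0 <= s -> small a s ->
  exists e, small (subcorner a s e) (s / 2).
Proof.
move=> s0 sm; apply: contrapT => /forallNP h.
suff : ((s ^+ d.+1)%:E <= \sum_(0 <= k <oo) (overlap (p k) (q k) a s)%:E)%E.
  by apply/negP; rewrite -ltNge.
rewrite (eq_eseriesr (g := fun k =>
    (\sum_e (overlap (p k) (q k) (subcorner a s e) (s / 2))%:E)%E)); last first.
  by move=> k _; rewrite sumEFin overlap_split// ?pq.
rewrite nneseries_sum; last by move=> e k _; rewrite lee_fin overlap_ge0.
apply: (@le_trans _ _ (\sum_(e : {ffun 'I_d.+1 -> bool}) ((s / 2) ^+ d.+1)%:E)).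
  rewrite sumEFin lee_fin sumr_const card_ffun card_bool card_ord.
  by rewrite -[leRHS]mulr_natr natrX -exprMn divfK.
by apply: lee_sum => e _; rewrite leNgt; apply/negP; exact: h.
Qed.

(* When a cube is bisected in every coordinate, at least one of the pieces is
   again covered in proportion less than 1; the point common to a nested sequence
   of such pieces lies in none of the open boxes. *)
Lemma uncovered a s : 0 < s -> small a s ->
  exists x, (forall i, a 0 i <= x 0 i <= a 0 i + s) /\
    forall k, ~ (forall i, p k 0 i < x 0 i < q k 0 i).
Proof.
move=> s0 sm.
have /choice[e eP] (as_ : E * R) : exists e : {ffun 'I_d.+1 -> bool},
    0 <= as_.2 -> small as_.1 as_.2 -> small (subcorner as_.1 as_.2 e) (as_.2 / 2).
  case: (pselect (0 <= as_.2 /\ small as_.1 as_.2)) => [[h1 h2]|h].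
    by have [e ?] := small_subcorner h1 h2; exists e.
  by exists [ffun=> true] => h1 h2; exfalso; apply: h.
pose fix u m : E := if m is m'.+1 then
  subcorner (u m') (s / 2 ^+ m') (e (u m', s / 2 ^+ m')) else a.
have sm0 m : 0 < s / 2 ^+ m by rewrite divr_gt0// exprn_gt0.
have sS m : s / 2 ^+ m / 2 = s / 2 ^+ m.+1.
  by rewrite exprSr invfM mulrA.
have smallu m : small (u m) (s / 2 ^+ m).
  elim: m => [|m ih]; first by rewrite expr0 divr1.
  by rewrite -sS; apply: (eP (u m, s / 2 ^+ m)) => //=; exact: ltW.
have nest m k i : u m 0 i <= u (m + k)%N 0 i /\
    u (m + k)%N 0 i + s / 2 ^+ (m + k) <= u m 0 i + s / 2 ^+ m.
  elim: k => [|k [ih1 ih2]]; first by rewrite addn0.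
  rewrite addnS /= /subcorner mxE -sS.
  have := sm0 (m + k)%N; case: (e _ i) => /= ?; split; lra.
have lo_hi m k i : u m 0 i <= u k 0 i + s / 2 ^+ k.
  have [mk|/ltnW mk] := leqP m k.
    by have [+ _] := nest m (k - m)%N i; rewrite subnKC//; have := sm0 k; lra.
  by have [_ +] := nest k (m - k)%N i; rewrite subnKC//; have := sm0 m; lra.
pose x : E := \row_i sup [set u m 0 i | m in [set: nat]].
have ux m i : u m 0 i <= x 0 i <= u m 0 i + s / 2 ^+ m.
  rewrite mxE; apply/andP; split.
    apply: ub_le_sup; last by exists m.
    by exists (a 0 i + s) => _ [k _ <-]; have := lo_hi k 0%N i; rewrite expr0 divr1.
  apply: ge_sup; first by exists (u 0%N 0 i), 0%N.
  by move=> _ [k _ <-]; exact: lo_hi.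
exists x; split; first by move=> i; have := ux 0%N i; rewrite expr0 divr1.
move=> k xk.
(* If [x] lay in the [k]-th open box, so would a whole late cube around it, and the overlap of this
   cube with that single box would already be its full volume. *)
have [e0 e00 he] : exists2 e0 : R, 0 < e0 &
    forall i, p k 0 i <= x 0 i - e0 /\ x 0 i + e0 <= q k 0 i.
  exists (\big[Num.min/1]_i Num.min (x 0 i - p k 0 i) (q k 0 i - x 0 i)).
    apply: lt_bigmin => // i _; have /andP[h1 h2] := xk i.
    by rewrite lt_min !subr_gt0 h1.
  move=> i; set M := \big[_/_]_i _.
  have : M <= Num.min (x 0 i - p k 0 i) (q k 0 i - x 0 i) by exact: bigmin_le_cond.
  by rewrite le_min => /andP[h1 h2]; split; lra.
have [m sme] : exists m, s / 2 ^+ m < e0. by exact: exists_half_lt.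
have := smallu m; rewrite /small; apply/negP; rewrite -leNgt.
apply: (@le_trans _ _ (overlap (p k) (q k) (u m) (s / 2 ^+ m))%:E).
  rewrite lee_fin /overlap (eq_bigr (fun=> s / 2 ^+ m)).
    by rewrite prodr_const card_ord.
  move=> i _; have [h1 h2] := he i; have /andP[h3 h4] := ux m i.
  have -> : Num.min (q k 0 i) (u m 0 i + s / 2 ^+ m) = u m 0 i + s / 2 ^+ m.
    by apply/min_r; lra.
  have -> : Num.max (p k 0 i) (u m 0 i) = u m 0 i by apply/max_r; lra.
  by rewrite addrAC subrr add0r max_l// ltW.
rewrite (nneseries_split 0 k.+1); last by move=> j _; rewrite lee_fin overlap_ge0.
rewrite add0n big_nat_recr//= -addeA addeCA leeDl// adde_ge0//.
  by apply: sume_ge0 => j _; rewrite lee_fin overlap_ge0.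
by apply: nneseries_ge0 => j _ _; rewrite lee_fin overlap_ge0.
Qed.
End bisection.

Lemma lebo_eball_neq0 c r : 0 < r -> lebo (eball c r) <> 0%E.
Proof.
move=> r0 ball0; pose s := r / (2 * d.+1%:R).
have s0 : 0 < s by rewrite divr_gt0// mulr_gt0.
(* One quarter of the volume of the cube is spent on the cover, another one on making its boxes
   open; the total stays below the full volume. *)
have D0 : 0 < s ^+ d.+1 / 4 by rewrite divr_gt0// exprn_gt0.
have box0 : lebo (box c (c + const_mx s)) = 0%E.
  apply/eqP; rewrite eq_le lebo_ge0 andbT -ball0; apply: le_lebo => x xc.
  have -> : r = d.+1%:R * (2 * s) by rewrite /s; field.
  apply: eball_sup => i; have [] := xc i; rewrite !mxE => h1 h2.
  by rewrite ger0_norm; lra.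
have fin : lebo (box c (c + const_mx s)) \is a fin_num by rewrite box0.
have [_ [p [q [cov ->]]]] := lb_ereal_inf_adherent D0 fin.
rewrite -/(lebo _) box0 add0e => vol.
have /choice[pq pqP] k : exists pq : E * E,
    (forall i, pq.1 0 i <= pq.2 0 i) /\
    (box (p k) (q k) `<=` [set x | forall i, pq.1 0 i < x 0 i < pq.2 0 i]) /\
    box_vol pq.1 pq.2 <= box_vol (p k) (q k) + s ^+ d.+1 / 4 / (2 ^ k.+1)%:R.
  have ek : 0 < s ^+ d.+1 / 4 / (2 ^ k.+1)%:R by rewrite divr_gt0// ltr0n expn_gt0.
  case: (pselect (forall i, p k 0 i <= q k 0 i)) => pqk.
    have [dl [dl0 h]] := box_vol_enlarge (p k) (q k) ek.
    exists (p k - const_mx dl, q k + const_mx dl); split=> [i|].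
      by rewrite !mxE; have := pqk i; lra.
    split => // x xpq i; rewrite !mxE; have [h1 h2] := xpq i.
    by apply/andP; split; lra.
  (* A box with an inverted side is empty, but [uncovered] asks for ordered corners: a degenerate
     box of volume 0 replaces it. *)
  exists (p k, p k); split => //; split.
    move=> x xpq; exfalso; apply: pqk => i; have [h1 h2] := xpq i.
    exact: le_trans h1 h2.
  by rewrite box_vol_diag addr_ge0 ?box_vol_ge0 ?ltW.
have [] := @uncovered (fst \o pq) (snd \o pq) (fun k => (pqP k).1) c s s0.
  apply: (@le_lt_trans _ _ (\sum_(0 <= k <oo)
      ((box_vol (p k) (q k))%:E + (s ^+ d.+1 / 4 / (2 ^ k.+1)%:R)%:E)%E)%E).
    apply: lee_nneseries => k _; first by rewrite lee_fin overlap_ge0.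
    rewrite -EFinD lee_fin; apply: le_trans (pqP k).2.2; exact: overlap_le.
  apply: le_lt_trans (epsilon_trick _ _ (ltW D0)) _.
    by move=> k; rewrite lee_fin box_vol_ge0.
  apply: (@lt_le_trans _ _ ((s ^+ d.+1 / 4)%:E + (s ^+ d.+1 / 4)%:E)%E).
    by rewrite lteD2rE.
  by rewrite -EFinD lee_fin; lra.
move=> x [xc h].
have /cov[k _ /((pqP k).2.1) /(h k)] // : box c (c + const_mx s) x.
by move=> i; have /andP[h1 h2] := xc i; rewrite !mxE.
Qed.

End lower_bound.

(** * Nondivergence for families of good functions *)

(* [dilation D k] is how much larger than the initial ball the domain of
   goodness has to be, and [nondiv_const D k] the constant lost, when at most
   [k] lattices can still be added to the flag. *)
Fixpoint dilation (D k : nat) : nat :=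
  if k is k'.+1 then (2 * D * dilation D k' + 1)%N else 1%N.

Fixpoint nondiv_const (D k : nat) : nat :=
  if k is k'.+1 then (((4 * D) ^ D + nondiv_const D k' * (2 * D) ^ D) * 2 ^ D)%N
  else 0%N.

Section nondivergence.
Context {R : realType} {d : nat}.
Local Notation E := 'rV[R]_d.+1.
Local Notation D := d.+1.
Implicit Types (a c x z : E) (r : R).

(** In the application [S] consists of lattices, [psi] is the covolume along the flow, [chain] means
    flag, [ext L s] means that [s] can be added to [L], and [bad] is the set of points with a short
    vector. *)
Variables (S : eqType) (psi : S -> E -> R).
Variables (ext : seq S -> S -> Prop) (chain : seq S -> Prop) (n : nat).
Variables (bad Omega : set E) (K eps rho : R).
Hypothesis rho1 : rho <= 1.
Hypothesis K0 : 0 <= K.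
Hypothesis chain_cons : forall L s, chain L -> ext L s -> chain (s :: L).
Hypothesis chain_size : forall L, chain L -> (size L <= n)%N.
Hypothesis ext_cons : forall L s s', ext (s :: L) s' -> ext L s'.
Hypothesis psi_cont : forall s x, Omega x -> psi s x < rho ->
  exists2 r : R, 0 < r & forall z, (forall i, `|z 0 i - x 0 i| < r) -> psi s z < rho.
Hypothesis psi_good : forall s c r, 0 < r -> eball c r `<=` Omega ->
  (exists2 z, eball c r z & rho <= psi s z) ->
  (lebo (eball c r `&` [set x | (psi s x < eps)%R]) <= (K * (2 * r) ^+ D)%:E)%E.
Hypothesis bad_ext : forall L x, chain L -> Omega x -> bad x ->
  (forall s, s \in L -> eps <= psi s x <= 1) ->
  exists2 s, ext L s & psi s x < rho.

Let pinned (L : seq S) : set E := bad `&` [set x | forall s, s \in L -> eps <= psi s x <= 1].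

Lemma eball_le c r1 r2 : r1 <= r2 -> eball c r1 `<=` @eball R D c r2.
Proof. by move=> r12 x /lt_le_trans; apply. Qed.

(* Stop the dyadic subdivision at the first cubes on which some [psi t] stays
   below [rho]. On the parent of such a cube every [psi s] still exceeds [rho]
   somewhere, so goodness bounds the part of the cube where [psi t < eps], and
   the induction hypothesis for [t :: L] bounds the rest. *)
Lemma lebo_pinned_le k L c r : chain L -> (n <= size L + k)%N -> 0 < r ->
  [set x : E | forall i, `|x 0 i - c 0 i| < (dilation D k)%:R * r] `<=` Omega ->
  (forall s, ext L s -> exists2 z, eball c r z & rho <= psi s z) ->
  (lebo (eball c r `&` pinned L) <= ((nondiv_const D k)%:R * K * r ^+ D)%:E)%E.
Proof.
elim: k L c r => [|k ih] L c r cL nL r0 cOm cover.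
  (* A bad pinned point would supply one more lattice, which a flag of full length cannot take. *)
  rewrite !mul0r (_ : _ `&` _ = set0) ?lebo_set0// -subset0 => x [cx [bx Lx]].
  have Ox : Omega x by apply: cOm => i; rewrite mul1r; exact: eball_coord.
  have [s Ls _] := bad_ext cL Ox bx Lx.
  by have := chain_size (chain_cons cL Ls); rewrite /= ltnNge -(addn0 (size L)) nL.
have D1 : 1 <= D%:R :> R by rewrite ler1n.
have dil1 j : 1 <= (dilation D j)%:R :> R by case: j => //= j; rewrite ler1n addn1.
pose mid a s : E := \row_i (a 0 i + s / 2).
(* Smallness is asked on a Euclidean ball containing the cube, because the failure of [P] on the
   parent must give the covering hypothesis on the very ball to which goodness and the induction
   hypothesis are applied. *)
pose P a s := exists2 t, ext L t &
  forall z, eball (mid a s) (D%:R * s) z -> psi t z < rho.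
pose I a s := [/\ 0 < s, s <= 2 * r &
  forall i, c 0 i - r <= a 0 i /\ a 0 i + s <= c 0 i + r].
pose A := eball c r `&` pinned L.
(* For a stopped cube of side s / 2 the ball of its parent has radius D s. Goodness costs the volume
   of a cube of side 2 D s, which is 4 D times s / 2, and the induction hypothesis costs (D s)^D.
   The remaining 2^D of [nondiv_const] comes from the initial side 2 r. *)
pose B : R := (4 * D%:R) ^+ D + (nondiv_const D k)%:R * (2 * D%:R) ^+ D.
have B0 : 0 <= B by rewrite addr_ge0 ?mulr_ge0 ?exprn_ge0 ?mulr_ge0.
have AOm : A `<=` Omega.
  move=> x [/eball_coord cx _]; apply: cOm => i.
  by apply: lt_le_trans (cx i) _; rewrite ler_peMl// ltW.
pose a0 : E := \row_i (c 0 i - r).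
have mid0 : mid a0 (2 * r) = c.
  by apply/rowP => i; rewrite !mxE; field.
have IA0 : I a0 (2 * r) by split; [lra|lra|move=> i; rewrite mxE; lra].
have nPA0 : ~ P a0 (2 * r).
  move=> [t /cover[z cz tz] hz]; have := hz z; rewrite mid0 ltNge tz => /(_ _)/negP.
  case; rewrite ?andbT //; apply: eball_le cz; rewrite mulrA.
  by rewrite ler_peMl ?ltW//; lra.
have A_cube : A = A `&` cube a0 (2 * r).
  apply/seteqP; split => [x [cx px]|x []//]; split => // i.
  by have := eball_coord i cx; rewrite mxE ltr_norml => /andP[h1 h2]; lra.
have -> : ((nondiv_const D k.+1)%:R * K * r ^+ D) = K * B * (2 * r) ^+ D.
  rewrite /= natrM natrD natrM !natrX !natrM [(2 * r) ^+ D]exprMn -/B.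
  by move: (B) (2 ^+ D) (r ^+ D) => u v w; ring.
rewrite -/A A_cube; apply: (@lebo_stopping _ _ P A I) => //.
- move=> a s e [s0 sr ha]; split; [lra|lra|move=> i].
  by rewrite /subcorner mxE; have := ha i; case: (e i) => /=; lra.
- by move=> a s [/ltW].
- move=> a s e [s0 sr ha] nP [t Lt tQ]; set Q := cube _ _.
  pose b := mid a s; pose r' := D%:R * s.
  have r'0 : 0 < r' by rewrite mulr_gt0.
  have bc i : `|b 0 i - c 0 i| <= r.
    by rewrite mxE ler_norml; have := ha i; lra.
  have Qb : Q `<=` eball b r'.
    move=> x /subcorner_cube ax; apply: eball_sup => i; have := ax i.
    by rewrite mxE ltr_norml; lra.
  (* This inclusion dictates the recursion of [dilation]: the radius [r'] is at most 2 D r, and the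
     centre [b] is within r of [c]. *)
  have bOm : [set x : E | forall i, `|x 0 i - b 0 i| < (dilation D k)%:R * r'] `<=` Omega.
    move=> x bx; apply: cOm => i; have := bx i; have := bc i.
    rewrite /= natrD !natrM.
    have : (dilation D k)%:R * r' <= 2 * D%:R * (dilation D k)%:R * r.
      rewrite /r' [leRHS](_ : _ = (dilation D k)%:R * (D%:R * (2 * r))); last by ring.
      by rewrite !ler_wpM2l.
    have := ler_distD (b 0 i) (x 0 i) (c 0 i); lra.
  have cover' s' : ext L s' -> exists2 z, eball b r' z & rho <= psi s' z.
    move=> Ls'; apply: contrapT => h; apply: nP; exists s' => // z bz.
    by rewrite ltNge; apply/negP => hz; apply: h; exists z.
  have bOm' : eball b r' `<=` Omega.
    move=> x bx; apply: bOm => i; apply: lt_le_trans (eball_coord i bx) _.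
    by rewrite ler_peMl// ltW.
  have AQ : A `&` Q `<=` (eball b r' `&` [set x | psi t x < eps]) `|`
      (eball b r' `&` pinned (t :: L)).
    move=> x [[cx [bx Lx]] Qx]; have bx' := Qb _ Qx.
    have [te|te] := ltP (psi t x) eps; [by left|right; split => //; split => //].
    move=> s'; rewrite inE => /predU1P[->|/Lx//]; rewrite te /=.
    apply: le_trans rho1; apply/ltW/tQ; apply: eball_sup => i; have := Qx i.
    by rewrite !mxE ltr_norml; lra.
  apply: le_trans (le_lebo AQ) _; apply: le_trans (outer_measureU2 _ _ _) _.
  have tc : chain (t :: L) by exact: chain_cons.
  have h1 := psi_good r'0 bOm' (cover' _ Lt).
  have h2 : (lebo (eball b r' `&` pinned (t :: L)) <=
      ((nondiv_const D k)%:R * K * r' ^+ D)%:E)%E.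
    apply: ih => //; first by rewrite /= addSnnS.
    by move=> s' /ext_cons; exact: cover'.
  apply: le_trans (leeD h1 h2) _; rewrite -EFinD lee_fin.
  rewrite le_eqVlt; apply/orP; left; apply/eqP.
  rewrite /r' /B.
  have -> : 2 * (D%:R * s) = (4 * D%:R) * (s / 2) by field.
  have -> : D%:R * s = (2 * D%:R) * (s / 2) by field.
  rewrite [(4 * _ * _) ^+ _]exprMn [(2 * _ * _) ^+ _]exprMn.
  by move: (_ ^+ D) (_ ^+ D) (_ ^+ D) => u v w; ring.
- by rewrite mulr_ge0.
- move=> x Ax; have [_ [bx Lx]] := Ax.
  have [t Lt xt] := bad_ext cL (AOm _ Ax) bx Lx.
  have [eta eta0 xeta] := psi_cont (AOm _ Ax) xt.
  (* The ball attached to a cube of side s containing x lies within distance 2 D s of x in each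
     coordinate. *)
  have [m hm] : exists m, 2 * r / 2 ^+ m < eta / (2 * D%:R).
    by apply: exists_half_lt; [rewrite mulr_gt0|rewrite divr_gt0// mulr_gt0].
  exists m => a' xa'; set s := 2 * r / 2 ^+ m in hm xa' *; exists t => // z az.
  apply: xeta => i; have := xa' i; have := eball_coord i az.
  have s0 : 0 < s by rewrite divr_gt0 ?exprn_gt0 ?mulr_gt0.
  have : 2 * D%:R * s < eta by rewrite mulrC -ltr_pdivlMr// mulr_gt0.
  have : s <= D%:R * s by rewrite ler_peMl// ltW.
  by rewrite mxE !ltr_norml; lra.
Qed.

End nondivergence.

(** * Hermite's inequality *)

Section hermite.
Context {R : realType}.

Definition qform j (G : 'M[R]_j) (x : 'cV[int]_j) : R :=
  ((map_mx intr x)^T *m G *m map_mx intr x) 0 0.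

Lemma qform_congr j (G : 'M[R]_j) (L : 'M[int]_j) x :
  qform ((map_mx intr L)^T *m G *m map_mx intr L) x = qform G (L *m x).
Proof. by rewrite /qform map_mxM trmx_mul !mulmxA. Qed.

Lemma qform_scale j (G : 'M[R]_j) (c : int) x :
  qform G (c *: x) = c%:~R ^+ 2 * qform G x.
Proof.
rewrite /qform (_ : map_mx intr (c *: x) = c%:~R *: map_mx intr x); last first.
  by apply/matrixP => i k; rewrite !mxE intrM.
set y := map_mx intr x.
have -> : (c%:~R *: y)^T = c%:~R *: y^T by apply/matrixP => i k; rewrite !mxE.
by rewrite -!scalemxAl -scalemxAr [LHS]mxE [X in _ * X]mxE expr2 mulrA.
Qed.

Lemma qform_gram m j (M : 'M[R]_(m, j)) x :
  qform (M^T *m M) x = \sum_i ((M *m map_mx intr x) i 0) ^+ 2.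
Proof.
rewrite /qform mulmxA -trmx_mul -mulmxA mxE.
by apply: eq_bigr => i _; rewrite mxE expr2.
Qed.

(** The Smith normal form of a one-column matrix: a nonzero integral vector is a multiple of one
    that extends to a basis. *)
Lemma primitive_column j (x : 'cV[int]_j.+1) : x != 0 ->
  exists2 L : 'M[int]_j.+1, L \in unitmx &
  exists2 c : int, c != 0 & x = c *: col 0 L.
Proof.
move=> x0; have [L uL [T uT [e _ xE]]] := int_Smith_normal_form x.
exists L => //; have {}xE : x = (e`_0 * T 0 0) *: col 0 L.
  rewrite xE; apply/matrixP => i k; rewrite !mxE big_ord1 !mxE ord1.
  rewrite big_ord_recl big1 ?addr0 => [|l _]; last by rewrite !mxE /= mulr0.
  by rewrite !mxE /= mulr1n ord1; ring.
exists (e`_0 * T 0 0) => //.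
by apply: contraNneq x0 => c0; rewrite xE c0 scale0r.
Qed.

Lemma unitmx_int_mul_neq0 j (L : 'M[int]_j) (x : 'cV_j) :
  L \in unitmx -> x != 0 -> L *m x != 0.
Proof.
by move=> uL; apply: contraNneq => Lx; rewrite -(mulKmx uL x) Lx mulmx0.
Qed.

Lemma nearest_int (y : R) : exists k : int, (k%:~R + y) ^+ 2 <= 4^-1.
Proof.
exists (- Num.floor (y + 2^-1)); rewrite intrN.
have := floor_itv (y + 2^-1); rewrite intrD.
set f := (Num.floor _)%:~R => /andP[h1 h2].
have : `|- f + y| <= 2^-1 by rewrite ler_norml; lra.
rewrite -(ler_pXn2r (n := 2))// ?nnegrE// real_normK ?num_real//.
by move=> /le_trans; apply; rewrite exprVn -natrX.
Qed.

(** * The Schur complement of the corner entry *)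

Section schur.
Variables (j : nat) (G : 'M[R]_(1 + j)).
Hypothesis symG : G^T = G.
Hypothesis G00 : G 0 0 != 0.

Let b : 'rV[R]_j := ursubmx G.
Definition schur : 'M[R]_j := drsubmx G - (G 0 0)^-1 *: (b^T *m b).

Lemma schur_sym : schur^T = schur.
Proof.
rewrite /schur linearB /= linearZ /= trmx_mul trmxK; congr (_ - _).
by rewrite -{2}symG -trmx_drsub.
Qed.

Lemma schur_block : G = block_mx 1%:M 0 ((G 0 0)^-1 *: b^T) 1%:M *m
  block_mx (G 0 0)%:M b 0 schur.
Proof.
rewrite mulmx_block !mul1mx !mul0mx ?mulmx0 !addr0.
rewrite -{1}[G]submxK; congr block_mx.
- apply/matrixP => i k; rewrite !mxE !ord1 mulr1n.
  by congr (G _ _); exact: val_inj.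
- rewrite -scalemxAl scalar_mxC mul_scalar_mx scalerA mulVf// scale1r.
  by rewrite /b trmx_ursub symG.
- by rewrite -scalemxAl /schur addrC subrK.
Qed.

Lemma det_schur : \det G = G 0 0 * \det schur.
Proof.
by rewrite {1}schur_block det_mulmx det_lblock det_ublock !det1 !mul1r det_scalar1.
Qed.

(** Completing the square in the first variable. The integer [k] remains free and can bring the
    square down to 1/4. *)
Lemma qform_schur (k : int) (x : 'cV[int]_j) :
  qform G (col_mx k%:M x) = qform schur x +
    G 0 0 * (k%:~R + (G 0 0)^-1 * (b *m map_mx intr x) 0 0) ^+ 2.
Proof.
rewrite /qform {1}schur_block map_col_mx tr_col_mx !mulmxA mul_row_block.
rewrite -mulmxA mul_block_col mul_row_col !mulmx1 !mulmx0 mul0mx !add0r.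
rewrite mulmxA mxE addrC; congr (_ + _).
set y := map_mx intr x; have -> : map_mx intr k%:M = (k%:~R : R)%:M :> 'M[R]_1.
  by apply/matrixP => i l; rewrite !mxE !ord1 !mulr1n.
rewrite mxE big_ord1 !mxE !mulr1n big_ord1 !mxE !mulr1n.
rewrite (_ : \sum_(_ < _) _ = (G 0 0)^-1 * (b *m y) 0 0); last first.
  by rewrite mxE mulr_sumr; apply: eq_bigr => l _; rewrite !mxE; ring.
by rewrite !mxE; field.
Qed.

End schur.

(** The passage from j to j + 1 halves the minimum and costs a factor 2^(-j); j^2 is a convenient
    bound for the sum of these exponents. *)
Definition hermite_const (j : nat) : R := 2^-1 ^+ (j * j).

Lemma hermite_const_gt0 j : 0 < hermite_const j.
Proof. by rewrite exprn_gt0. Qed.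

(* Hermite's induction: after an integral change of basis the corner entry is
   within a factor 2 of the minimum of the form, and the Schur complement then
   takes values at least half that minimum. *)
Lemma hermite_det j (G : 'M[R]_j) (m : R) : 0 < m -> G^T = G ->
  (forall x, x != 0 -> m <= qform G x) -> hermite_const j * m ^+ j <= \det G.
Proof.
elim: j G m => [|j ih] G m m0 symG mG.
  by rewrite det_mx00 /hermite_const !expr0 mul1r.
pose S := [set qform G x | x in [set x | x != 0]].
have delta0 : delta_mx 0 0 != 0 :> 'cV[int]_j.+1.
  by apply/eqP => /matrixP/(_ 0 0); rewrite !mxE.
have lbS : lbound S m by move=> _ [x x0 <-]; exact: mG.
have infS : has_inf S by split; [exists (qform G (delta_mx 0 0)), (delta_mx 0 0)|exists m].
pose mu := inf S.
have m_mu : m <= mu by apply: lb_le_inf => //; exact: infS.1.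
have mu0 : 0 < mu by exact: lt_le_trans m_mu.
have mu_le x : x != 0 -> mu <= qform G x.
  by move=> x0; apply: ge_inf; [exact: infS.2|exists x].
(* The infimum is not known to be attained; a value below 2 [mu] suffices, and dividing [x] by its
   content can only decrease it. *)
have [_ [x x0 <-] xmu] := inf_adherent mu0 infS.
have [L uL [c c0 xE]] := primitive_column x0.
pose LR : 'M[R]_j.+1 := map_mx intr L; pose H : 'M[R]_(1 + j) := LR^T *m G *m LR.
have detH : \det H = \det G.
  rewrite !det_mulmx det_tr mulrAC -expr2.
  have /orP[] : (\det L == 1) || (\det L == -1) by move: uL; rewrite unitmxE.
    by move/eqP => d1; rewrite det_map_mx d1 expr1n mul1r.
  by move/eqP => d1; rewrite det_map_mx d1 rmorphN rmorph1 sqrrN expr1n mul1r.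
have H00 : H 0 0 = qform G (col 0 L).
  rewrite (_ : col 0 L = L *m delta_mx 0 0); last by rewrite colE.
  rewrite -qform_congr -/LR -/H /qform.
  rewrite (_ : map_mx intr _ = delta_mx 0 0); last first.
    by apply/matrixP => i k; rewrite !mxE; case: (_ && _).
  by rewrite trmx_delta -rowE -colE !mxE.
have y0 : col 0 L != 0.
  by apply: contraNneq x0 => y0; rewrite xE y0 scaler0.
have H00_ge : mu <= H 0 0 by rewrite H00 mu_le.
have H00_lt : H 0 0 < 2 * mu.
  rewrite H00; apply: (@le_lt_trans _ _ (qform G x)); last by rewrite mulr_natl mulr2n.
  rewrite xE qform_scale ler_peMl//; first exact: le_trans (ltW mu0) (mu_le _ y0).
  rewrite -[leRHS]real_normK ?num_real// expr_ge1// -intr_norm.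
  by rewrite (ler_int _ 1) -gtz0_ge1 normr_gt0.
have symH : H^T = H by rewrite /H !trmx_mul trmxK symG mulmxA.
have H00_neq0 : H 0 0 != 0 by rewrite gt_eqF// (lt_le_trans mu0).
have schur_ge z : z != 0 -> mu / 2 <= qform (schur H) z.
  move=> z0; have [k hk] := nearest_int ((H 0 0)^-1 * (ursubmx H *m map_mx intr z) 0 0).
  have := qform_schur symH H00_neq0 k z.
  have : mu <= qform H (col_mx k%:M z).
    rewrite qform_congr; apply: mu_le; apply: unitmx_int_mul_neq0 => //.
    by apply: contraNneq z0 => h; rewrite -(col_mxKd k%:M z) h linear0.
  move=> + e; rewrite e => h.
  have : H 0 0 * (k%:~R + (H 0 0)^-1 * (ursubmx H *m map_mx intr z) 0 0) ^+ 2 <= H 0 0 * 4^-1.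
    by rewrite ler_wpM2l// (le_trans (ltW mu0)).
  lra.
have := ih _ _ (divr_gt0 mu0 (ltr0Sn _ 1)) (schur_sym symH) schur_ge.
rewrite -detH (det_schur symH H00_neq0) => h.
apply: (@le_trans _ _ (mu * (hermite_const j * (mu / 2) ^+ j))); last first.
  by apply: ler_pM => //; rewrite ?mulr_ge0 ?exprn_ge0 ?divr_ge0 ?ltW.
rewrite exprMn mulrCA [mu * _]mulrA -exprS mulrCA [leRHS]mulrC.
apply: ler_pM.
- exact: ltW (hermite_const_gt0 _).
- by rewrite exprn_ge0 ?ltW.
- rewrite /hermite_const -exprD; apply: ler_wiXn2l; rewrite ?invr_ge0 ?invf_le1 ?ler1n//.
  by rewrite mulSn mulnS [(j + j * j)%N]addnC leq_addl.
- by apply: lerXn2r => //; rewrite nnegrE ltW.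
Qed.

End hermite.

(** * Norms of exterior products *)

Section wedge.
Context {R : realType}.

Lemma wedge_norm_ge0 m j (M : 'M[R]_(m, j)) : 0 <= wedge_norm M.
Proof. exact: bigmax_ge_id. Qed.

Lemma injective_increasing_perm j m (s : 'I_j -> 'I_m) : injective s ->
  exists2 s' : {ffun 'I_j -> 'I_m},
    [forall i : 'I_j, forall k : 'I_j, (i < k)%N ==> (s' i < s' k)%N] &
  exists p : 'S_j, forall i, s i = s' (p i).
Proof.
move=> injs; pose A := [set s i | i in 'I_j]%SET.
have cA : #|A| = j by rewrite card_imset// card_ord.
have sA i : s i \in A by apply/imsetP; exists i.
pose p i := cast_ord cA (enum_rank_in (sA i) (s i)).
have injp : injective p.
  move=> i k /cast_ord_inj/(congr1 enum_val).
  by rewrite !enum_rankK_in// => /injs.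
exists [ffun i => enum_val (cast_ord (esym cA) i)]; last first.
  by exists (perm injp) => i; rewrite permE ffunE /p cast_ordK enum_rankK_in.
apply/'forall_forallP => i k; apply/implyP => ik; rewrite !ffunE.
have sorted_enum : sorted ltn (map val (enum A)).
  rewrite sorted_map /enum_mem -enumT.
  apply: sorted_filter; first by move=> x y z; exact: ltn_trans.
  rewrite -(@sorted_map _ _ val ltn) val_enum_ord.
  exact: iota_ltn_sorted.
have sA' : size (enum A) = j by rewrite -cardE.
have := sorted_ltn_nth ltn_trans (val (s i)) sorted_enum.
move=> /(_ (val i) (val k)); rewrite !inE size_map sA' !ltn_ord => /(_ isT isT ik).
have e (l : 'I_#|A|) : enum_val l = nth (s i) (enum A) l := enum_val_nth _ l.
by rewrite !e !(nth_map (s i)) ?sA' ?ltn_ord.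
Qed.

(** A repeated row kills the minor and reordering rows changes its sign only, so increasing
    selections see all of them. *)
Lemma det_rowsub_le_wedge m j (M : 'M[R]_(m, j)) (s : 'I_j -> 'I_m) :
  `|\det (rowsub s M)| <= wedge_norm M.
Proof.
have [/injectiveP injs|/injectivePn[i1 [i2 i12 s12]]] := boolP (injectiveb s); last first.
  rewrite (determinant_alternate i12) ?normr0 ?wedge_norm_ge0// => k.
  by rewrite !mxE s12.
have [s' incs' [p ps]] := injective_increasing_perm injs.
have -> : rowsub s M = perm_mx p *m rowsub s' M.
  by rewrite -row_permE; apply/matrixP => i k; rewrite !mxE ps.
rewrite det_mulmx det_perm normrM normr_sign mul1r.
exact: (@le_bigmax_cond _ _ _ _ s').
Qed.

Lemma wedge_norm_le m j (M : 'M[R]_(m, j)) x : 0 <= x ->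
  (forall s : 'I_j -> 'I_m, `|\det (rowsub s M)| <= x) -> wedge_norm M <= x.
Proof. by move=> x0 h; apply: bigmax_le => // s _; exact: h. Qed.

Lemma wedge_norm_mulmxr m j (M : 'M[R]_(m, j)) (A : 'M[R]_j) :
  1 <= `|\det A| -> wedge_norm M <= wedge_norm (M *m A).
Proof.
move=> A1; apply: wedge_norm_le => [|s]; first exact: wedge_norm_ge0.
apply: le_trans (det_rowsub_le_wedge _ s).
have -> : rowsub s (M *m A) = rowsub s M *m A.
  by apply/matrixP => i k; rewrite !mxE; apply: eq_bigr => l _; rewrite !mxE.
by rewrite det_mulmx normrM ler_peMr.
Qed.

(** Laplace expansion along the new column, which has 1 + j terms. *)
Lemma wedge_norm_row_mx m j (u : 'cV[R]_m) (M : 'M[R]_(m, j)) (e : R) :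
  0 <= e -> (forall i, `|u i 0| <= e) ->
  wedge_norm (row_mx u M) <= (1 + j)%:R * (e * wedge_norm M).
Proof.
move=> e0 ue; apply: wedge_norm_le => [|s].
  by rewrite !mulr_ge0 ?wedge_norm_ge0.
rewrite (expand_det_col _ 0); apply: le_trans (ler_norm_sum _ _ _) _.
have -> : (1 + j)%:R * (e * wedge_norm M) = \sum_(i < 1 + j) (e * wedge_norm M).
  by rewrite sumr_const card_ord mulr_natl.
apply: ler_sum => i _; rewrite normrM; apply: ler_pM => //.
  rewrite !mxE; have -> : 0 = lshift j (0 : 'I_1) by exact: val_inj.
  by rewrite (unsplitK (inl _)) ue.
rewrite /cofactor normrM normrX normrN1 expr1n mul1r.
apply: le_trans (det_rowsub_le_wedge M (s \o lift i)).
rewrite (_ : row' _ _ = rowsub (s \o lift i) M)//.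
apply/matrixP => k l; rewrite !mxE /=.
have -> : lift 0 l = rshift 1 l by exact: val_inj.
by rewrite (unsplitK (inr _)).
Qed.

Lemma exists_max_minor m j (N : 'M[R]_(m, j)) : \rank N = j ->
  exists s : {ffun 'I_j -> 'I_m}, \det (rowsub s N) != 0 /\
    forall s' : 'I_j -> 'I_m, `|\det (rowsub s' N)| <= `|\det (rowsub s N)|.
Proof.
move=> rN; have fN : row_full N by rewrite /row_full rN.
pose s0 := fullrankfun fN.
exists [arg max_(s > s0) `|\det (rowsub s N)|]%O.
case: arg_maxP => // s _ smax; split.
  have := smax s0 isT; apply: contraTneq => /= ->; rewrite normr0 -ltNge normr_gt0.
  by rewrite -unitfE -unitmxE fullrowsub_unit.
move=> s'; have := smax [ffun i => s' i] isT.
rewrite /= (_ : rowsub [ffun i => s' i] N = rowsub s' N)//.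
by apply/matrixP => i k; rewrite !mxE ffunE.
Qed.

(* The coordinates of a column of [N] in terms of a maximal minor are ratios of
   minors, hence at most 1. *)
Lemma max_minor_bound m j (N : 'M[R]_(m, j)) (s : {ffun 'I_j -> 'I_m}) :
  \det (rowsub s N) != 0 ->
  (forall s' : 'I_j -> 'I_m, `|\det (rowsub s' N)| <= `|\det (rowsub s N)|) ->
  forall (x : 'cV_j) i,
    `|(N *m x) i 0| <= \sum_k `|(rowsub s N *m x) k 0|.
Proof.
move=> D0 smax x i; set M := rowsub s N in D0 smax *.
have adjM k : `|(row i N *m \adj M) 0 k| <= `|\det M|.
  pose s' l := if l == k then i else s l.
  apply: le_trans (smax s'); rewrite le_eqVlt; apply/orP; left; apply/eqP.
  congr `|_|; rewrite (expand_det_row _ k) mxE; apply: eq_bigr => l _.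
  rewrite !mxE /s' eqxx; congr (_ * (_ * \det _)).
  by apply/matrixP => a b; rewrite !mxE eq_sym (negbTE (neq_lift _ _)).
have e : \det M * (N *m x) i 0 = \sum_k (row i N *m \adj M) 0 k * (M *m x) k 0.
  have -> : \sum_k (row i N *m \adj M) 0 k * (M *m x) k 0 =
      (row i N *m \adj M *m (M *m x)) 0 0 by rewrite [RHS]mxE.
  rewrite mulmxA -(mulmxA (row i N)) mul_adj_mx mul_mx_scalar -scalemxAl.
  by rewrite -row_mul !mxE.
rewrite -(ler_pM2l (_ : 0 < `|\det M|)) ?normr_gt0// -normrM e.
apply: le_trans (ler_norm_sum _ _ _) _; rewrite mulr_sumr.
by apply: ler_sum => k _; rewrite normrM ler_wpM2r.
Qed.

(** Hermite's inequality is applied to the Gram matrix of a maximal square block rather than of [N],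
    since its determinant is the square of a single minor. Restricting vectors to that block costs
    the factor [j] in [e / j%:R]. *)
Lemma wedge_norm_lower m j (N : 'M[R]_(m, j)) (e : R) : (0 < j)%N ->
  \rank N = j -> 0 < e ->
  (forall x : 'cV[int]_j, x != 0 -> exists i, e <= `|(N *m map_mx intr x) i 0|) ->
  hermite_const j * ((e / j%:R) ^+ 2) ^+ j <= wedge_norm N ^+ 2.
Proof.
move=> j0 rN e0 h; have [s [D0 smax]] := exists_max_minor rN.
set M := rowsub s N in D0 smax.
have ej : 0 < e / j%:R by rewrite divr_gt0// ltr0n.
apply: (@le_trans _ _ (\det (M^T *m M))); last first.
  rewrite det_mulmx det_tr -expr2 -real_normK ?num_real//.
  by rewrite ler_pXn2r ?nnegrE ?wedge_norm_ge0// det_rowsub_le_wedge.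
apply: hermite_det; first by rewrite exprn_gt0.
  by rewrite trmx_mul trmxK.
move=> x /h[i ei]; rewrite qform_gram.
have {}ei := le_trans ei (max_minor_bound D0 smax _ i).
have [k hk] : exists k, e / j%:R <= `|(M *m map_mx intr x) k 0|.
  apply: contrapT => /forallNP hk; move: ei; apply/negP; rewrite -ltNge.
  have -> : e = \sum_(k < j) (e / j%:R).
    by rewrite sumr_const card_ord -[RHS]mulr_natr divfK// pnatr_eq0 -lt0n.
  apply: ltr_sum; first by apply/hasP; exists (Ordinal j0); rewrite ?mem_index_enum.
  by move=> k _; rewrite ltNge; apply/negP/hk.
rewrite (bigD1 k)//= -[leLHS]addr0 lerD ?sumr_ge0//; last by move=> *; exact: sqr_ge0.
by rewrite -[leRHS]real_normK ?num_real// ler_pXn2r ?nnegrE// ltW.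
Qed.

End wedge.

(** * Flags of integral lattices *)

Lemma seq_argmax (T : eqType) (h : T -> nat) (q : seq T) : q != [::] ->
  exists2 b, b \in q & forall a, a \in q -> (h a <= h b)%N.
Proof.
elim: q => // x [|y q] ih _.
  by exists x; rewrite ?mem_head// => a; rewrite inE => /eqP ->.
have [b bq hb] := ih isT; have [xb|/ltnW bx] := leqP (h x) (h b).
  by exists b => [|a]; rewrite in_cons ?bq ?orbT// => /predU1P[->|/hb].
exists x => [|a]; rewrite in_cons ?eqxx// => /predU1P[->//|/hb].
by move=> /leq_trans; apply.
Qed.

Section flags.
Context {R : realType} {n : nat}.
Local Notation toR := (map_mx (@intmul R 1)).

(** Only spans are compared, so lattices with the same span are not told apart; [minimal] later
    selects among them. *)
Definition span_le r s (V : 'M[int]_(n.+1, r)) (W : 'M[int]_(n.+1, s)) :=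
  ((toR V)^T <= (toR W)^T)%MS.

Lemma span_le_trans r s t (V : 'M[int]_(n.+1, r)) (W : 'M[int]_(n.+1, s))
  (X : 'M[int]_(n.+1, t)) : span_le V W -> span_le W X -> span_le V X.
Proof. exact: submx_trans. Qed.

Lemma span_le_rank r s (V : 'M[int]_(n.+1, r)) (W : 'M[int]_(n.+1, s)) :
  span_le V W -> (\rank (toR V) <= \rank (toR W))%N.
Proof. by move=> /mxrankS; rewrite !mxrank_tr. Qed.

Lemma span_le_sym r s (V : 'M[int]_(n.+1, r)) (W : 'M[int]_(n.+1, s)) :
  span_le V W -> (\rank (toR W) <= \rank (toR V))%N -> span_le W V.
Proof.
move=> VW WV; have [_] := mxrank_leqif_sup VW; rewrite /span_le => <-.
by rewrite !mxrank_tr eqn_leq WV span_le_rank.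
Qed.

Lemma span_eq_rank r s (V : 'M[int]_(n.+1, r)) (W : 'M[int]_(n.+1, s)) :
  span_le V W -> span_le W V -> \rank (toR V) = \rank (toR W).
Proof. by move=> VW WV; apply/eqP; rewrite eqn_leq !span_le_rank. Qed.

Lemma full_rank_mul_neq0 r (V : 'M[int]_(n.+1, r)) (x : 'cV_r) :
  \rank (toR V) = r -> x != 0 -> V *m x != 0.
Proof.
move=> rV; apply: contraNneq => Vx.
have fV : row_free (toR V)^T by rewrite /row_free mxrank_tr rV.
have : (toR x)^T *m (toR V)^T = 0 *m (toR V)^T.
  by rewrite mul0mx -trmx_mul -map_mxM Vx map_mx0 trmx0.
move/(row_free_inj fV)/(congr1 trmx); rewrite trmxK trmx0 => /matrixP x0.
apply/eqP/matrixP => i k; have /eqP := x0 i k; rewrite !mxE.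
by rewrite intr_eq0 => /eqP.
Qed.

Definition gram r (V : 'M[int]_(n.+1, r)) : R := \det ((toR V)^T *m toR V).

(* Minimality of the covolume within the rational span stands in for
   primitivity: it is all that the flag argument needs, and it avoids
   saturating lattices. *)
Definition minimal r (V : 'M[int]_(n.+1, r)) := forall W : 'M[int]_(n.+1, r),
  span_le V W -> span_le W V -> gram V <= gram W.

Lemma gram_int r (V : 'M[int]_(n.+1, r)) : gram V = (\det (V^T *m V))%:~R.
Proof. by rewrite /gram map_trmx -map_mxM det_map_mx. Qed.

(** Hermite's inequality with minimum 1: nonzero integral vectors are sent to nonzero integral
    vectors. *)
Lemma gram_gt0 r (V : 'M[int]_(n.+1, r)) : \rank (toR V) = r -> 0 < gram V.
Proof.
move=> rV; apply: (@lt_le_trans _ _ (hermite_const r * 1 ^+ r)).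
  by rewrite expr1n mulr1 hermite_const_gt0.
apply: hermite_det => //; first by rewrite trmx_mul trmxK.
move=> x x0; rewrite qform_gram.
have /eqP Vx := full_rank_mul_neq0 rV x0; have [i Vxi] : exists i, (V *m x) i 0 != 0.
  apply: contrapT => /forallNP h; apply: Vx; apply/matrixP => i k.
  by rewrite ord1 [RHS]mxE; apply/eqP; apply: contrapT => /negP; exact: h.
rewrite (bigD1 i)//= -[leLHS]addr0 lerD ?sumr_ge0//; last by move=> *; exact: sqr_ge0.
rewrite -map_mxM mxE -[leRHS]real_normK ?num_real// expr_ge1// -intr_norm.
by rewrite (ler_int _ 1) -gtz0_ge1 normr_gt0.
Qed.

Lemma exists_minimal r (V : 'M[int]_(n.+1, r)) : \rank (toR V) = r ->
  exists W : 'M[int]_(n.+1, r), [/\ span_le V W, span_le W V & minimal W].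
Proof.
move=> rV; pose same (W : 'M[int]_(n.+1, r)) := span_le V W && span_le W V.
pose P k := `[< exists2 W, same W & k = `|\det (W^T *m W)|%N >].
have exP : exists k, P k.
  exists `|\det (V^T *m V)|%N; apply/asboolP; exists V => //.
  by rewrite /same /span_le submx_refl.
have gramE (W : 'M[int]_(n.+1, r)) : same W -> gram W = `|\det (W^T *m W)|%N%:R.
  move=> /andP[VW WV]; have rW : \rank (toR W) = r by rewrite (span_eq_rank WV).
  rewrite -(ger0_norm (ltW (gram_gt0 rW))) gram_int -intr_norm.
  by rewrite natr_absz.
case: (ex_minnP exP) => k /asboolP[W sW ->] kmin; exists W.
have [VW WV] := andP sW; split => // X WX XW.
have sX : same X by rewrite /same (span_le_trans VW WX) (span_le_trans XW WV).
by rewrite !gramE// ler_nat kmin//; apply/asboolP; exists X.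
Qed.

(** Both bases span the same space, so W = V A for a real square A. The ratio of covolumes is |det
    A| whatever [g] is; minimality, stated without [g], makes it at least 1. *)
Lemma minimal_wedge_le r r' (V : 'M[int]_(n.+1, r)) (W : 'M[int]_(n.+1, r'))
    (g : 'M[R]_n.+1) : r = r' ->
  \rank (toR V) = r -> minimal V -> span_le V W -> span_le W V ->
  wedge_norm (g *m toR V) <= wedge_norm (g *m toR W).
Proof.
move=> e; move: W; rewrite -{r'}e => W rV minV VW WV; have /submxP[A AE] := WV.
have WE : toR W = toR V *m A^T by rewrite -[LHS]trmxK AE trmx_mul trmxK.
rewrite WE mulmxA; apply: wedge_norm_mulmxr.
have := minV _ VW WV.
rewrite /gram WE trmx_mul trmxK -mulmxA det_mulmx (mulmxA _ (toR V)) det_mulmx.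
rewrite -/(gram V) det_tr mulrCA -expr2 -ler_pdivrMl ?gram_gt0// mulVf; last first.
  by rewrite gt_eqF// gram_gt0.
by rewrite -real_normK ?num_real// expr_ge1.
Qed.

Local Notation lat := {r : nat & 'M[int]_(n.+1, r)}.
Implicit Types (L : seq lat) (a b s : lat).

Definition minimal_lattice a := lattice_basis R (tagged a) /\ minimal (tagged a).

Definition comparable_lattices a b :=
  span_le (tagged a) (tagged b) || span_le (tagged b) (tagged a).

(** The list is unordered: distinct ranks and pairwise comparable spans already make it a strictly
    nested chain. *)
Definition flag L := [/\ uniq (map tag L),
  forall a, a \in L -> minimal_lattice a &
  forall a b, a \in L -> b \in L -> comparable_lattices a b].

Definition flag_ext L s := minimal_lattice s /\
  forall a, a \in L -> tag a != tag s /\ comparable_lattices a s.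

Lemma flag_nil : flag [::].
Proof. by split. Qed.

Lemma flag_cons L s : flag L -> flag_ext L s -> flag (s :: L).
Proof.
move=> [uL mL cL] [ms cs]; split.
- rewrite /= uL andbT; apply/mapP => -[a /cs[+ _]] e.
  by rewrite e eqxx.
- by move=> a; rewrite inE => /predU1P[->//|/mL].
- have cC a b : comparable_lattices a b = comparable_lattices b a.
    by rewrite /comparable_lattices orbC.
  move=> a b; rewrite !inE => /predU1P[->|aL] /predU1P[->|bL].
  + by rewrite /comparable_lattices /span_le submx_refl.
  + by rewrite cC; have [] := cs b bL.
  + by have [] := cs a aL.
  + exact: cL.
Qed.

Lemma flag_size L : flag L -> (size L <= n)%N.
Proof.
move=> [uL mL _]; rewrite -(size_map tag) -[leqRHS](size_iota 1).
apply: uniq_leq_size => // _ /mapP[a /mL[[/andP[h1 h2] _] _] ->].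
by rewrite mem_iota h1 add1n ltnS.
Qed.

Lemma flag_ext_cons L s s' : flag_ext (s :: L) s' -> flag_ext L s'.
Proof.
by move=> [ms cs]; split => // a aL; apply: cs; rewrite inE aL orbT.
Qed.

Definition lattice_norm (g : 'M[R]_n.+1) a := wedge_norm (g *m toR (tagged a)).

(* [B] spans the largest member of the flag that does not contain [v]
   (and is the empty basis when all of them do). *)
Lemma flag_split (g : 'M[R]_n.+1) L (v : 'cV[int]_n.+1) : flag L -> v != 0 ->
  (forall a, a \in L -> lattice_norm g a <= 1) ->
  exists r (B : 'M[int]_(n.+1, r)), [/\ \rank (toR B) = r, ~~ span_le v B,
    wedge_norm (g *m toR B) <= 1 &
    forall a, a \in L -> if span_le v (tagged a) then span_le B (tagged a)
                         else span_le (tagged a) B].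
Proof.
move=> [uL mL cL] v0 L1.
pose L' := [seq a <- L | ~~ span_le v (tagged a)].
have [L'0|L'0] := eqVneq L' [::].
  exists 0%N, 0; split.
  - by apply/eqP; rewrite -leqn0 rank_leq_col.
  - apply: contra v0; move=> /submxP[D]; rewrite [D]thinmx0 mul0mx.
    move=> /(congr1 trmx); rewrite trmxK trmx0 => /matrixP h.
    apply/eqP/matrixP => i k; have /eqP := h i k; rewrite !mxE.
    by rewrite intr_eq0 => /eqP.
  - by apply: wedge_norm_le => // s; rewrite det_mx00 normr1.
  - move=> a aL; case: ifPn => [_|va]; first by rewrite /span_le map_mx0 trmx0 sub0mx.
    have : a \in L' by rewrite mem_filter va.
    by rewrite L'0.
have [b bL' bmax] := @seq_argmax _ tag _ L'0.
move: (bL'); rewrite mem_filter => /andP[vb bL].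
have rk a : a \in L -> \rank (toR (tagged a)) = tag a.
  by move=> /mL[[_ +] _].
exists (tag b), (tagged b); split => //; [exact: rk|exact: L1|move=> a aL].
have /orP[ab|ba] := cL _ _ aL bL; case: ifPn => // va.
- by move: vb; rewrite (span_le_trans va ab).
- apply: span_le_sym => //; rewrite !rk//; apply: bmax.
  by rewrite mem_filter va.
Qed.

Lemma rank_row_mx r (v : 'cV[int]_n.+1) (B : 'M[int]_(n.+1, r)) :
  \rank (toR B) = r -> ~~ span_le v B -> \rank (toR (row_mx v B)) = r.+1.
Proof.
move=> rB vB; apply/eqP; rewrite eqn_leq rank_leq_col /=.
rewrite map_row_mx -mxrank_tr tr_row_mx -addsmxE -{1}rB -mxrank_tr.
apply: rank_ltmx; rewrite ltmxE addsmxSr /=.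
by apply: contra vB => h; apply: submx_trans h; exact: addsmxSl.
Qed.

Lemma span_le_row_mx r j (v : 'cV[int]_n.+1) (B : 'M[int]_(n.+1, r))
    (A : 'M[int]_(n.+1, j)) :
  span_le (row_mx v B) A = span_le v A && span_le B A.
Proof. by rewrite /span_le map_row_mx tr_row_mx col_mx_sub. Qed.

Lemma wedge_norm_full r (W : 'M[int]_(n.+1, r)) (g : 'M[R]_n.+1) :
  \det g = 1 -> r = n.+1 -> \rank (toR W) = r -> 1 <= wedge_norm (g *m toR W).
Proof.
move=> g1 e; move: W; rewrite e => W rW.
apply: le_trans (det_rowsub_le_wedge _ id).
rewrite (_ : rowsub id _ = g *m toR W); last by apply/matrixP => i k; rewrite !mxE.
rewrite det_mulmx g1 mul1r det_map_mx -intr_norm (ler_int _ 1) -gtz0_ge1 normr_gt0.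
apply: contra_eq_neq rW => d0; rewrite ltn_eqF// ltn_neqAle rank_leq_row andbT.
by rewrite -/(row_free _) row_free_unit unitmxE det_map_mx d0 unitfE eqxx.
Qed.

(* Adjoining the short vector [v] to [B] gives a lattice of very small covolume;
   by minimality of the members of the flag it cannot be one of them. *)
Lemma flag_extension (g : 'M[R]_n.+1) L (v : 'cV[int]_n.+1) (eta eps rho : R) :
  \det g = 1 -> flag L -> v != 0 -> 0 <= eta ->
  (forall i, `|(g *m toR v) i 0| <= eta) ->
  n.+1%:R * eta < eps -> eps <= rho -> rho <= 1 ->
  (forall a, a \in L -> eps <= lattice_norm g a <= 1) ->
  exists2 s, flag_ext L s & lattice_norm g s < rho.
Proof.
move=> g1 fL v0 eta0 gv eta_eps eps_rho rho1 L_eps.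
have [r [B [rB vB B1 splitL]]] := flag_split fL v0 (fun a aL => proj2 (andP (L_eps a aL))).
have [uL mL cL] := fL.
pose W0 : 'M[int]_(n.+1, 1 + r) := row_mx v B.
have rW0 : \rank (toR W0) = r.+1 by exact: rank_row_mx.
have rn : (r <= n)%N by rewrite -ltnS -rW0 rank_leq_row.
have W0_eps : wedge_norm (g *m toR W0) < eps.
  apply: le_lt_trans eta_eps; rewrite /W0 map_row_mx mul_mx_row.
  apply: le_trans (wedge_norm_row_mx _ eta0 gv) _.
  apply: ler_pM; rewrite ?ler_nat ?ltnS ?mulr_ge0 ?wedge_norm_ge0//.
  by rewrite ler_piMr.
(* A lattice of full rank n + 1 has norm at least 1 because [g] is unimodular; hence the new lattice
   has rank at most n, as [lattice_basis] demands. *)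
have {}rn : (r < n)%N.
  rewrite ltn_neqAle rn andbT; apply/eqP => e.
  have : 1 <= wedge_norm (g *m toR W0).
    by apply: wedge_norm_full => //; rewrite e.
  by rewrite leNgt (lt_le_trans W0_eps)// (le_trans eps_rho).
have [W [W0W WW0 minW]] := exists_minimal rW0.
have rW : \rank (toR W) = r.+1 by rewrite (span_eq_rank WW0).
have BW0 : span_le B W0.
  move: (submx_refl (toR W0)^T); rewrite -/(span_le W0 W0).
  by rewrite {1}span_le_row_mx => /andP[].
exists (Tagged (fun r => 'M[int]_(n.+1, r)) W); last first.
  apply: lt_le_trans eps_rho; apply: le_lt_trans W0_eps.
  exact: minimal_wedge_le.
split; first by split; first split.
move=> a aL; have := splitL _ aL; case: ifPn => va Ba; split.
- apply/eqP => /= ea; have [[_ ra] ma] := mL _ aL.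
  have W0a : span_le W0 (tagged a) by rewrite span_le_row_mx va Ba.
  have {}ra : \rank (toR (tagged a)) = tag a := ra.
  have aW0 : span_le (tagged a) W0 by apply: span_le_sym => //; rewrite rW0 ra ea.
  have := L_eps _ aL; rewrite /lattice_norm.
  move=> /andP[+ _]; rewrite leNgt => /negP; apply.
  by apply: le_lt_trans W0_eps; exact: minimal_wedge_le.
- rewrite /comparable_lattices /=; apply/orP; right.
  by apply: span_le_trans WW0 _; rewrite span_le_row_mx va.
- apply/eqP => /= ea; have [[_ ra] ma] := mL _ aL.
  by have := span_le_rank Ba; rewrite ra rB ea ltnn.
- rewrite /comparable_lattices /=; apply/orP; left.
  by apply: span_le_trans W0W; exact: span_le_trans BW0.
Qed.

End flags.

(** * Goodness of the covolume functions *)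

Section affine_minors.
Context {R : realType} {n : nat}.
Local Notation toR := (map_mx (@intmul R 1)).

Definition affine (F : 'rV[R]_n -> R) := exists (c0 : R) (c : 'rV[R]_n),
  forall y, F y = c0 + \sum_i c 0 i * y 0 i.

Lemma affine_cst (a : R) : affine (fun=> a).
Proof.
by exists a, 0 => y; rewrite big1 ?addr0// => i _; rewrite mxE mul0r.
Qed.

Lemma affine_scale (a : R) F : affine F -> affine (fun y => a * F y).
Proof.
move=> [c0 [c h]]; exists (a * c0), (a *: c) => y; rewrite h mulrDr mulr_sumr.
by congr (_ + _); apply: eq_bigr => i _; rewrite mxE mulrA.
Qed.

Lemma affine_sum (I : finType) (F : I -> 'rV[R]_n -> R) :
  (forall i, affine (F i)) -> affine (fun y => \sum_i F i y).
Proof.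
move=> /choice[c0] /choice[c h]; exists (\sum_i c0 i), (\sum_i c i) => y.
under eq_bigr do rewrite h.
rewrite big_split exchange_big /=; congr (_ + _); apply: eq_bigr => i _.
by rewrite summxE mulr_suml.
Qed.

(** Laplace expansion along the only row that depends on y; the cofactors avoid this row and are
    constant. For [g_t] times [u_y] it is the top row. *)
Lemma affine_det m j (G : 'rV[R]_n -> 'M[R]_(m, j)) (i0 : 'I_m) :
  (forall i y l, i != i0 -> G y i l = G 0 i l) ->
  (forall l, affine (fun y => G y i0 l)) ->
  forall s : 'I_j -> 'I_m, affine (fun y => \det (rowsub s (G y))).
Proof.
move=> cstG affG s.
have [/injectiveP injs|/injectivePn[k1 [k2 k12 s12]]] := boolP (injectiveb s); last first.
  rewrite (_ : (fun _ => _) = (fun=> 0)); first exact: affine_cst.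
  apply/funext => y; apply: (determinant_alternate k12) => k.
  by rewrite !mxE s12.
have [[k sk]|sN] := pselect (exists k, s k = i0); last first.
  rewrite (_ : (fun _ => _) = (fun=> \det (rowsub s (G 0)))); first exact: affine_cst.
  apply/funext => y; congr (\det _); apply/matrixP => a b; rewrite !mxE cstG//.
  by apply/eqP => sa; apply: sN; exists a.
rewrite (_ : (fun _ => _) = fun y => \sum_l cofactor (rowsub s (G 0)) k l * G y i0 l).
  by apply: affine_sum => l; exact: affine_scale.
apply/funext => y; rewrite (expand_det_row _ k); apply: eq_bigr => l _.
rewrite mulrC [rowsub _ _ _ _]mxE sk; congr (_ * \det _ * _).
apply/matrixP => a b; rewrite !mxE cstG// -sk.
by apply: contra (neq_lift k a) => /eqP/injs ->.
Qed.

Lemma det_g_t (t : 'rV[R]_n) : \det (g_t t) = 1.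
Proof.
rewrite /g_t det_ublock det_scalar1 det_diag /tsum expR_sum -big_split /=.
by rewrite big1// => i _; rewrite mxE -expRD subrr expR0.
Qed.

Lemma det_u_y (y : 'rV[R]_n) : \det (u_y y) = 1.
Proof. by rewrite /u_y det_ublock !det1 mulr1. Qed.

Lemma g_t_u_yE (t y : 'rV[R]_n) j (V : 'M[R]_(1 + n, j)) :
  g_t t *m u_y y *m V = col_mx
    (expR (tsum t) *: (usubmx V + y *m dsubmx V))
    (diag_mx (map_mx (fun s => expR (- s)) t) *m dsubmx V).
Proof.
rewrite -mulmxA -{1}[V]vsubmxK /u_y mul_block_col !mul1mx mul0mx add0r.
by rewrite /g_t mul_block_col !mul0mx addr0 add0r mul_scalar_mx.
Qed.

Lemma minor_affine (t : 'rV[R]_n) j (V : 'M[R]_(1 + n, j)) (s : 'I_j -> 'I_(1 + n)) :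
  affine (fun y => \det (rowsub s (g_t t *m u_y y *m V))).
Proof.
apply: (@affine_det _ _ (fun y => g_t t *m u_y y *m V) (lshift n 0)).
  move=> i y l; rewrite !g_t_u_yE; case: (split_ordP i) => k ->.
    by rewrite ord1 eqxx.
  by move=> _; rewrite !col_mxEd.
move=> l; rewrite (_ : (fun _ => _) = fun y : 'rV[R]_n => expR (tsum t) *
    (V (lshift n 0) l + \sum_i V (rshift 1 i) l * y 0 i)).
  by apply: affine_scale; exists (V (lshift n 0) l), (\row_i V (rshift 1 i) l) => y;
    congr (_ + _); apply: eq_bigr => i _; rewrite mxE.
apply/funext => y; rewrite g_t_u_yE col_mxEu !mxE; congr (_ * (_ + _)).
by apply: eq_bigr => i _; rewrite !mxE mulrC.
Qed.

End affine_minors.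

Definition has_short_vector {R : realType} {n : nat} (g : 'M[R]_n.+1) (eta : R) :=
  exists2 v : 'cV[int]_n.+1, v != 0 & forall i, `|(g *m map_mx intr v) i 0| <= eta.

(** * Sublevel sets of the covolume functions *)

Section good_functions.
Context {R : realType} {d n : nat}.
Local Notation E := 'rV[R]_d.+1.
Local Notation D := d.+1.
Local Notation toR := (map_mx (@intmul R 1)).

Lemma CA_good_sublevel (C alpha : R) (V : set E) (h : E -> R) c r (eps rho : R) :
  0 <= C -> CA_good C alpha V h -> 0 < r -> eball c r `<=` V -> 0 < eps -> 0 < rho ->
  (exists2 z, eball c r z & rho <= `|h z|) ->
  (lebo (eball c r `&` [set x | (`|h x| < eps)%R]) <=
     (C * (eps / rho) `^ alpha * (2 * r) ^+ D)%:E)%E.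
Proof.
move=> C0 good r0 cV e0 rho0 [z cz hz].
have er0 : 0 < eps / rho by rewrite divr_gt0.
rewrite EFinM; apply: (@le_trans _ _
    ((C * (eps / rho) `^ alpha)%:E * lebo (eball c r))%E); last first.
  rewrite lee_wpmul2l ?lebo_eball_le// lee_fin mulr_ge0 ?powR_ge0//.
apply: le_trans (good c r r0 cV _ er0); apply: le_lebo => x [cx xe]; split => //.
apply: (@lt_le_trans _ _ ((eps / rho)%:E * (rho%:E))%E).
  by rewrite -EFinM lte_fin divfK ?gt_eqF.
have h1 : (`|h z|%:E <= ereal_sup [set `|h y|%:E | y in eball c r])%E.
  by apply: ereal_sup_ubound; exists z.
apply: lee_wpmul2l; first by rewrite lee_fin ltW.
by apply: le_trans h1; rewrite lee_fin.
Qed.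

Variables (U : set E) (f : E -> 'rV[R]_n).
Hypothesis openU : open U.
Hypothesis contf : {within U, continuous f}.

Let psi (t : 'rV[R]_n) j (V : 'M[R]_(1 + n, j)) x :=
  wedge_norm (g_t t *m u_y (f x) *m V).

(** A maximum of good functions is as good as its members: one minor reaches [rho], and where the
    maximum is below [eps] so is this minor. *)
Lemma wedge_norm_good (C alpha : R) (Om : set E) c r (eps rho : R) t j
  (V : 'M[R]_(1 + n, j)) : 0 <= C ->
  (forall (c0 : R) (c : 'rV[R]_n),
    CA_good C alpha Om (fun x => c0 + \sum_(i < n) c 0 i * f x 0 i)) ->
  0 < r -> eball c r `<=` Om -> 0 < eps -> 0 < rho ->
  (exists2 z, eball c r z & rho <= psi t V z) ->
  (lebo (eball c r `&` [set x | (psi t V x < eps)%R]) <=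
     (C * (eps / rho) `^ alpha * (2 * r) ^+ D)%:E)%E.
Proof.
move=> C0 good r0 cOm e0 rho0 [z cz hz].
have [s hs] : exists s : 'I_j -> 'I_(1 + n),
    rho <= `|\det (rowsub s (g_t t *m u_y (f z) *m V))|.
  apply: contrapT => /forallNP h; move: hz; apply/negP; rewrite -ltNge.
  by apply: bigmax_lt => // s _; rewrite ltNge; apply/negP/h.
have [c0 [c' hc]] := minor_affine t V s.
apply: (@le_trans _ _ (lebo (eball c r `&`
    [set x | (`|c0 + \sum_(i < n) c' 0 i * f x 0 i| < eps)%R]))).
  apply: le_lebo => x [cx xe]; split => //=; rewrite -hc.
  exact: le_lt_trans (det_rowsub_le_wedge _ s) xe.
apply: CA_good_sublevel (good c0 c') _ _ _ _ _ => //.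
by exists z; rewrite // -hc.
Qed.

Lemma wedge_norm_continuous t j (V : 'M[R]_(1 + n, j)) x (rho : R) : U x ->
  psi t V x < rho ->
  exists2 r : R, 0 < r & forall z : E, (forall i, `|z 0 i - x 0 i| < r) -> psi t V z < rho.
Proof.
move=> Ux xrho.
have fx : {for x, continuous f}.
  by move: contf; rewrite continuous_open_subspace// => /(_ x); apply; rewrite inE.
have rho0 : 0 < rho by apply: le_lt_trans xrho; exact: wedge_norm_ge0.
have near_lt (s : {ffun 'I_j -> 'I_(1 + n)}) :
    \forall z \near x, `|\det (rowsub s (g_t t *m u_y (f z) *m V))| < rho.
  have [c0 [c hc]] := minor_affine t V s.
  have : (fun z => \det (rowsub s (g_t t *m u_y (f z) *m V))) @ x -->
      \det (rowsub s (g_t t *m u_y (f x) *m V)).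
    rewrite (_ : (fun z => _) = fun z : E => c0 + \sum_i c 0 i * f z 0 i); last first.
      by apply/funext.
    rewrite hc.
    apply: (@cvgD R R _ (nbhs x) _ (fun=> c0) (fun z : E => \sum_i c 0 i * f z 0 i)).
      exact: cvg_cst.
    apply: cvg_big => [|i _]; first exact: add_continuous.
    apply: (@cvgM R _ (nbhs x) _ (fun=> c 0 i) (fun z : E => f z 0 i)).
      exact: cvg_cst.
    exact: (cvg_comp _ _ fx (@coord_continuous R 1 n 0 i (f x))).
  move=> /cvg_norm/cvgr_lt; apply.
  by apply: le_lt_trans xrho; exact: det_rowsub_le_wedge.
have [r r0 hr] := nbhs_coord (@filter_forall _ _ _ _ (nbhs_filter x) near_lt).
by exists r => // z /hr zx; apply: bigmax_lt.
Qed.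

Lemma lebo_short_vector_le (C alpha : R) (Om : set E) (c : E) (r eta eps rho : R)
    (t : 'rV[R]_n) :
  0 <= C ->
  (forall (c0 : R) (c : 'rV[R]_n),
    CA_good C alpha Om (fun x => c0 + \sum_(i < n) c 0 i * f x 0 i)) ->
  Om `<=` U -> 0 < r ->
  [set x : E | forall i, `|x 0 i - c 0 i| < (dilation D n)%:R * r] `<=` Om ->
  0 < eta -> n.+1%:R * eta < eps -> eps <= rho -> rho <= 1 ->
  (forall j (V : 'M[int]_(n.+1, j)), lattice_basis R V ->
    exists2 z, eball c r z & rho <= psi t (toR V) z) ->
  (lebo (eball c r `&` [set x | has_short_vector (g_t t *m u_y (f x)) eta]) <=
     ((nondiv_const D n)%:R * (C * (eps / rho) `^ alpha) * r ^+ D)%:E)%E.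
Proof.
move=> C0 good OmU r0 cOm eta0 eta_eps eps_rho rho1 cover.
have eps0 : 0 < eps by apply: le_lt_trans eta_eps; rewrite mulr_ge0// ltW.
have rho0 : 0 < rho by exact: lt_le_trans eps_rho.
set bad := [set x | _].
have := @lebo_pinned_le R d _ (fun a x => lattice_norm (g_t t *m u_y (f x)) a)
  (@flag_ext R n) (@flag R n) n bad Om (C * (eps / rho) `^ alpha) eps rho rho1.
move=> /(_ _ (@flag_cons R n) (@flag_size R n) (@flag_ext_cons R n)) h.
have := h _ _ _ _ n [::] c r (@flag_nil R n).
rewrite (_ : bad `&` [set x | _] = bad); last first.
  by apply/seteqP; split => [x []//|x bx]; split.
apply => //.
- by rewrite mulr_ge0// powR_ge0.
- by move=> s x /OmU Ux; exact: wedge_norm_continuous.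
- move=> s c' r' r'0 c'Om hz; exact: wedge_norm_good hz.
- move=> L x fL Omx [v v0 hv] L_eps.
  apply: flag_extension v0 (ltW eta0) hv eta_eps eps_rho rho1 L_eps => //.
  by rewrite det_mulmx det_g_t det_u_y mulr1.
- by move=> s [[ms _] _]; exact: cover.
Qed.

End good_functions.

(** * Dani's correspondence *)

Section dirichlet.
Context {R : realType} {n : nat}.
Hypothesis n0 : (0 < n)%N.
Local Notation toR := (map_mx (@intmul R 1)).
Implicit Types (y t : 'rV[R]_n) (q : 'rV[int]_n).

Let approx y q (p : int) : R := \sum_i y 0 i * (q 0 i)%:~R + p%:~R.

Lemma flow_vec_top t y (v : 'cV[int]_(1 + n)) :
  (g_t t *m u_y y *m toR v) (lshift n 0) 0 =
  expR (tsum t) * approx y (dsubmx v)^T (v (lshift n 0) 0).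
Proof.
rewrite g_t_u_yE col_mxEu !mxE addrC; congr (_ * (_ + _)).
by apply: eq_bigr => i _; rewrite !mxE.
Qed.

Lemma flow_vec_down t y (v : 'cV[int]_(1 + n)) i :
  (g_t t *m u_y y *m toR v) (rshift 1 i) 0 =
  expR (- t 0 i) * ((dsubmx v)^T 0 i)%:~R.
Proof. by rewrite g_t_u_yE col_mxEd mul_diag_mx !mxE. Qed.

Lemma has_short_vectorE t y e : has_short_vector (g_t t *m u_y y) e <->
  exists q p, [/\ (q != 0) || (p != 0), expR (tsum t) * `|approx y q p| <= e &
    forall i, expR (- t 0 i) * `|(q 0 i)%:~R| <= e].
Proof.
split=> [[v v0 hv]|[q [p [qp h1 h2]]]].
  exists (dsubmx (v : 'cV_(1 + n)))^T, ((v : 'cV_(1 + n)) (lshift n 0) 0); split.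
  - apply: contraNT v0; rewrite negb_or !negbK => /andP[/eqP q0 /eqP p0].
    apply/eqP/matrixP => i k; rewrite ord1 mxE.
    case: (split_ordP (i : 'I_(1 + n))) => l ->; first by rewrite ord1.
    by have /matrixP/(_ 0 l) := q0; rewrite !mxE.
  - have := hv (lshift n (0 : 'I_1)).
    by rewrite flow_vec_top normrM ger0_norm ?expR_ge0.
  - move=> i; have := hv (rshift 1 i).
    by rewrite flow_vec_down normrM ger0_norm ?expR_ge0.
pose v : 'cV[int]_(1 + n) := col_mx p%:M q^T.
have vq : (dsubmx v)^T = q by rewrite col_mxKd trmxK.
have vp : v (lshift n 0) 0 = p by rewrite col_mxEu mxE eqxx mulr1n.
exists v => [|i].
  apply: contraTneq qp => v0; rewrite -vq -vp v0 negb_or !negbK.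
  by rewrite linear0 trmx0 mxE !eqxx.
case: (split_ordP (i : 'I_(1 + n))) => l ->.
  by rewrite ord1 flow_vec_top vq vp normrM ger0_norm ?expR_ge0.
by rewrite flow_vec_down vq normrM ger0_norm ?expR_ge0.
Qed.

Lemma Pi_plus_ge1 q : 1 <= Pi_plus R q.
Proof.
rewrite /Pi_plus; elim/big_ind : _ => // [a b a1 b1|i _].
  by rewrite -[leLHS]mulr1 ler_pM.
by rewrite le_max lexx orbT.
Qed.

Lemma Pi_plus_ge q i : `|(q 0 i)%:~R| <= Pi_plus R q.
Proof.
rewrite /Pi_plus (bigD1 i)//= -[leLHS]mulr1; apply: ler_pM => //.
  by rewrite le_max lexx.
elim/big_ind : _ => // [a b a1 b1|k _]; first by rewrite -[leLHS]mulr1 ler_pM.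
by rewrite le_max lexx orbT.
Qed.

Lemma Pi_plus_powR q (s : R) : Pi_plus R q `^ s = expR (s * ln (Pi_plus R q)).
Proof. by rewrite /powR gt_eqF// (lt_le_trans ltr01 (Pi_plus_ge1 q)). Qed.

Lemma finite_Pi_plus_le (x : R) : finite_set [set q : 'rV[int]_n | Pi_plus R q <= x].
Proof.
pose N := Num.truncn x; pose h (a : {ffun 'I_n -> 'I_(2 * N + 1)}) : 'rV[int]_n :=
  \row_i ((a i)%:Z - N%:Z).
apply: (@sub_finite_set _ _ (h @` setT)); last by apply: finite_image; exact: finite_finset.
move=> q /= qx.
have qN i : (`|q ord0 i| <= N)%N.
  rewrite -ltnS; have := le_lt_trans (le_trans (Pi_plus_ge q i) qx) (truncnS_gt x).
  by rewrite -intr_norm -natr_absz ltr_nat.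
have lt i : (`|(q ord0 i + N%:Z)%R| < 2 * N + 1)%N by have := qN i; lia.
exists [ffun i => Ordinal (lt i)] => //.
apply/rowP => i; rewrite mxE ffunE /=; have := qN i.
rewrite (_ : q 0 i = q ord0 i); [lia|by congr (q _ _); exact: val_inj].
Qed.

Lemma nonint_dist (z : R) : (forall p : int, z + p%:~R != 0) ->
  exists2 e : R, 0 < e & forall p : int, e <= `|z + p%:~R|.
Proof.
move=> z0; have /andP[h1 h2] := floor_itv z; set f := Num.floor z in h1 h2.
have h1' : f%:~R < z.
  rewrite lt_neqAle h1 andbT; apply: contraNneq (z0 (- f)) => <-.
  by rewrite intrN subrr.
exists (Num.min (z - f%:~R) ((f + 1)%:~R - z)); first by rewrite lt_min !subr_gt0 h1'.
move=> p; rewrite ge_min; have [pf|pf] := leP (- p) f.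
  apply/orP; left; apply: le_trans (ler_norm _).
  by rewrite lerD2l -intrN ler_int lerNl.
apply/orP; right; rewrite -normrN; apply: le_trans (ler_norm _).
by rewrite opprD addrC lerD2l -intrN ler_int lezD1.
Qed.

Lemma exists_expRN_lt (a e : R) : 0 < a -> 0 < e -> exists2 T, 0 < T &
  forall s, T <= s -> expR (- (a * s)) < e.
Proof.
move=> a0 e0; exists (e^-1 / a); first by rewrite divr_gt0// invr_gt0.
move=> s sT; rewrite expRN -[ltRHS]invrK ltf_pV2 ?posrE ?expR_gt0 ?invr_gt0//.
apply: lt_le_trans (expR_ge1Dx _).
have : e^-1 <= a * s by rewrite mulrC -ler_pdivrMr.
lra.
Qed.

(** From |q_i| < e^(t_i) and t_i >= 0 follows Pi_+(q) <= e^t, while |yq + p| <= e^(-(1 + gam) t);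
    hence the exponent v = n (1 + gam). *)
Lemma VWMA_of_short_vectors y (gam : R) : 0 < gam ->
  (forall T : R, exists t, [/\ forall i, 0 <= t 0 i, T <= tsum t &
     has_short_vector (g_t t *m u_y y) (expR (- (gam * tsum t)))]) ->
  VWMA y.
Proof.
move=> gam0 short; exists (n%:R * (1 + gam)); split.
  by rewrite ltr_pMr ?ltr0n//; lra.
rewrite [_ * _ / _]mulrAC divff ?mul1r ?pnatr_eq0 -?lt0n//.
set A := [set q | _] => finA.
have key T : 0 < T -> exists q p, [/\ q != 0,
    `|approx y q p| <= expR (- (1 + gam) * T) &
    `|approx y q p| <= Pi_plus R q `^ (- (1 + gam))].
  move=> T0; have [t [t0 Tt /has_short_vectorE[q [p [qp h1 h2]]]]] := short T.
  have tT := lt_le_trans T0 Tt.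
  have e1 : expR (- (gam * tsum t)) < 1 by rewrite expR_lt1 oppr_lt0 mulr_gt0.
  have happ : `|approx y q p| <= expR (- (1 + gam) * tsum t).
    rewrite -(ler_pM2l (expR_gt0 (tsum t))); apply: le_trans h1 _.
    by rewrite -expRD ler_expR; lra.
  exists q, p; split.
  - apply: contraTneq h1 => q0; rewrite q0 eqxx /= in qp; rewrite -ltNge.
    apply: lt_le_trans e1 _; rewrite /approx big1 => [|i _]; last first.
      by rewrite q0 mxE mulr0.
    rewrite add0r -[leLHS]mulr1; apply: ler_pM => //; first by rewrite -expR0 ler_expR ltW.
    by rewrite -intr_norm (ler_int _ 1) -gtz0_ge1 normr_gt0.
  - by apply: le_trans happ _; rewrite ler_expR ler_nM2l//; lra.
  - apply: le_trans happ _; rewrite Pi_plus_powR ler_expR ler_nM2l; last by lra.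
    rewrite -(ler_expR (ln _)) lnK ?posrE ?(lt_le_trans ltr01 (Pi_plus_ge1 q))//.
    rewrite /tsum expR_sum; apply: ler_prod => i _; rewrite le_max ler01 orbT /=.
    rewrite ge_max -{2}expR0 ler_expR t0 andbT -[leRHS]mul1r.
    rewrite -ler_pdivrMr ?expR_gt0// -expRN mulrC.
    by apply: le_trans (h2 i) _; exact: ltW.
(* An exact relation [q y + p = 0] gives infinitely many solutions [k (q, p)];
   without one, each [q] can serve only boundedly large times. *)
have [[q [p [q0 qp]]]|nz] := pselect (exists q p, q != 0 /\ approx y q p = 0).
  have [i qi] : exists i, q 0 i != 0.
    apply: contrapT => /forallNP h; move/eqP: q0; apply; apply/rowP => i.
    by rewrite mxE; apply/eqP; apply: contrapT => /negP; exact: h.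
  apply: infinite_nat; rewrite (_ : [set: nat] = (fun k => q *+ k) @^-1` A).
    apply: finite_preimage finA => k l _ _ /rowP/(_ i).
    by rewrite !mulmxnE => /(mulrIn qi).
  apply/seteqP; split => // k _; exists (p *+ k).
  have -> : \sum_(i < n) y 0 i * ((q *+ k) 0 i)%:~R + (p *+ k)%:~R = approx y q p *+ k.
    rewrite /approx mulrnDl -sumrMnl; congr (_ + _); last by rewrite raddfMn.
    by apply: eq_bigr => l _; rewrite mulmxnE raddfMn mulrnAr.
  by rewrite qp mul0rn normr0 powR_ge0.
have /choice[e he] q : exists e : R, 0 < e /\ (q != 0 -> forall p, e <= `|approx y q p|).
  have [->|q0] := eqVneq q 0; first by exists 1; split => //.
  have [e e0 he] : exists2 e : R, 0 < e & forall p : int, e <= `|approx y q p|.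
    apply: nonint_dist => p; apply/eqP => h; apply: nz; by exists q, p.
  by exists e.
have [s As] := (finite_seqP A).1 finA.
have e0 : 0 < \big[Num.min/1]_(q <- s) e q.
  by rewrite big_seq; apply: lt_bigmin => // q _; exact: (he q).1.
have [T T0 hT] := exists_expRN_lt (ltr_pwDl ltr01 (ltW gam0)) e0.
have [q [p [q0 h1 h2]]] := key T T0.
have qs : q \in s by have Aq : A q; [exists p|rewrite As in Aq].
have := hT T (lexx T); apply/negP; rewrite -leNgt -mulNr.
apply: le_trans h1; apply: le_trans ((he q).2 q0 p).
exact: ge_bigmin_seq.
Qed.

(** Integral t and rates 1 / (k + 1) turn the exceptional set into a countable union to which
    Borel-Cantelli applies. *)
Lemma short_vectors_of_VWMA y : VWMA y -> exists k : nat, forall M : nat,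
  exists t : {ffun 'I_n -> nat}, (M <= \sum_i t i)%N /\
    has_short_vector (g_t (\row_i (t i)%:R) *m u_y y)
      (expR (- (k.+1%:R^-1 * (\sum_i t i)%:R))).
Proof.
move=> [v [vn infA]]; pose N : R := n%:R; have N1 : 1 <= N by rewrite ler1n.
have N0 : 0 < N by lra.
(* The excess v / n - 1 equals 2 N [dl]. With L = ln Pi_+(q), half of it raises each t_i by [dl] L
   above ln max(|q_i|, 1), which makes the lower coordinates small; the other half keeps the top
   coordinate small. *)
pose dl := (v / N - 1) / (2 * N).
have dl0 : 0 < dl.
  by rewrite divr_gt0 ?mulr_gt0// subr_gt0 ltr_pdivlMr// mul1r.
have vE : v / N = 1 + 2 * N * dl by rewrite /dl; field; rewrite gt_eqF.
pose a := 1 + N * dl; have a1 : 1 < a by rewrite ltrDl mulr_gt0.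
have a0 : 0 < a by lra.
have [k hk] : exists k : nat, k.+1%:R^-1 <= dl / (2 * a).
  exists (Num.truncn (2 * a / dl)); rewrite -[leRHS]invf_div.
  have a_dl : 0 < 2 * a / dl by rewrite divr_gt0// mulr_gt0.
  rewrite lef_pV2 ?posrE//.
  exact/ltW/truncnS_gt.
exists k => M; set gam : R := k.+1%:R^-1.
have gam0 : 0 < gam by rewrite invr_gt0.
have gam1 : gam <= 1 by rewrite invf_le1// ler1n.
(* The first term makes [dl] L at least 4 N, enough to absorb rounding each t_i up to an integer;
   the second makes the sum of the t_i at least [M]. *)
pose X := expR (4 * N / dl + M%:R).
have [q [[p qp] qX]] : exists q, (exists p : int,
    `|approx y q p| <= Pi_plus R q `^ (- (v / N))) /\ X < Pi_plus R q.
  apply: contrapT => /forallNP h; apply: infA.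
  apply: sub_finite_set (finite_Pi_plus_le X) => q hq /=.
  by rewrite leNgt; apply/negP => hX; apply: (h q).
pose L := ln (Pi_plus R q); have P1 := Pi_plus_ge1 q.
have P0 : 0 < Pi_plus R q by lra.
have LX : 4 * N / dl + M%:R < L.
  by rewrite -ltr_expR lnK ?posrE.
have L1 : 4 * N <= L * dl.
  by rewrite -ler_pdivrMr//; have : 0 <= M%:R :> R by []; lra.
have L0 : 0 <= L by exact: ln_ge0.
pose x i := ln (Num.max `|(q 0 i)%:~R| 1) + dl * L.
have max1 i : 1 <= Num.max `|(q 0 i)%:~R : R| 1 by rewrite le_max lexx orbT.
have x0 i : 0 <= x i by rewrite addr_ge0 ?ln_ge0// mulr_ge0// ltW.
have sumx : \sum_i x i = a * L.
  rewrite big_split sumr_const card_ord /=.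
  have -> : \sum_i ln (Num.max `|(q 0 i)%:~R : R| 1) = L.
    apply: expR_inj; rewrite expR_sum lnK ?posrE//; apply: eq_bigr => i _.
    by rewrite lnK// posrE (lt_le_trans ltr01).
  by rewrite -mulr_natl /a /N; ring.
pose t : {ffun 'I_n -> nat} := [ffun i => (Num.truncn (x i)).+1].
have tx i : x i <= (t i)%:R <= x i + 1.
  have /andP[h1 h2] := truncn_itv (x0 i).
  by rewrite ffunE (ltW h2) -natr1 lerD2r.
have tl : a * L <= (\sum_i t i)%:R.
  by rewrite -sumx natr_sum; apply: ler_sum => i _; have /andP[] := tx i.
have tu : (\sum_i t i)%:R <= a * L + N.
  rewrite -sumx natr_sum /N -[n in n%:R]card_ord -sumr_const -big_split.
  by apply: ler_sum => i _; have /andP[] := tx i.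
have aL : L <= a * L by rewrite ler_peMl// ltW.
have Ndl : 0 < N / dl by rewrite divr_gt0.
exists t; split.
  by rewrite -(ler_nat R); move: LX tl aL Ndl; rewrite -mulrA; lra.
have tsE : tsum (\row_i (t i)%:R : 'rV[R]_n) = (\sum_i t i)%:R.
  by rewrite /tsum natr_sum; apply: eq_bigr => i _; rewrite mxE.
set tau : R := (\sum_i t i)%:R in tl tu tsE *.
have gtau : gam * tau <= L * dl / 2 + N.
  apply: (@le_trans _ _ (gam * (a * L) + gam * N)).
    by rewrite -mulrDr ler_wpM2l// ltW.
  apply: lerD; last by rewrite ler_piMl// ltW.
  have -> : L * dl / 2 = dl / (2 * a) * (a * L) by field; rewrite gt_eqF//; lra.
  by rewrite ler_wpM2r// mulr_ge0//; lra.
apply/has_short_vectorE; exists q, p; rewrite tsE; split.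
- apply/orP; left; apply: contraTneq (lt_trans _ qX : 1 < Pi_plus R q) => [->|].
    rewrite /Pi_plus big1 ?ltxx// => i _.
    by rewrite mxE normr0; apply/max_idPr.
  by rewrite expR_gt1; have : 0 <= M%:R :> R by []; lra.
- apply: (@le_trans _ _ (expR tau * expR (- (v / N) * L))).
    by rewrite ler_wpM2l ?expR_ge0// -Pi_plus_powR.
  rewrite -expRD ler_expR vE.
  have : N * (L * dl) >= L * dl by rewrite ler_peMl// mulr_ge0// ltW.
  by move: tu gtau L1; rewrite /a; nra.
- move=> i; rewrite mxE.
  apply: (@le_trans _ _ (expR (- x i) * Num.max `|(q 0 i)%:~R| 1)).
    apply: ler_pM; rewrite ?expR_ge0 ?le_max ?lexx//.
    by rewrite ler_expR lerN2; have /andP[] := tx i.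
  rewrite -[Num.max _ _ as X in _ * X]lnK ?posrE ?(lt_le_trans ltr01 (max1 i))//.
  rewrite -expRD ler_expR /x; lra.
Qed.

End dirichlet.

(** * Short vectors from small covolume *)

Section small_covolume.
Context {R : realType} {n : nat}.
Local Notation toR := (map_mx (@intmul R 1)).

(** If all vectors were longer than e = exp(-beta tau / (2n)), the squared norm would be at least c
    e^(2n) = c exp(-beta tau). It is less than exp(-2 beta tau), and the spare factor exp(-beta tau)
    beats the constant c for large tau. *)
Lemma short_vector_of_small_wedge (beta : R) : 0 < beta -> exists2 T : R, 0 < T &
  forall (tau : R) (g : 'M[R]_n.+1) j (V : 'M[int]_(n.+1, j)), T <= tau ->
    g \in unitmx -> lattice_basis R V ->
    wedge_norm (g *m toR V) < expR (- (beta * tau)) ->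
    has_short_vector g (expR (- (beta / (2 * n%:R) * tau))).
Proof.
move=> beta0; pose c : R := hermite_const n * (n%:R^-1 ^+ 2) ^+ n.
have [->|n0] := posnP n.
  exists 1 => // tau g j V _ _ [/andP[j0 jn]].
  by move: j0; rewrite ltnNge jn.
have nR : 0 < n%:R :> R by rewrite ltr0n.
have c0 : 0 < c by rewrite mulr_gt0 ?hermite_const_gt0 ?exprn_gt0 ?invr_gt0.
have [T T0 hT] := exists_expRN_lt beta0 c0.
exists T => // tau g j V Ttau ug [/andP[j0 jn] rV] small.
have tau0 : 0 < tau by exact: lt_le_trans Ttau.
set e := expR _; apply: contrapT => nshort.
have e0 : 0 < e by exact: expR_gt0.
have {}rV : \rank (toR V) = j := rV.
have rgV : \rank (g *m toR V) = j.
  by rewrite eqmxMfull ?row_full_unit.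
have long (x : 'cV[int]_j) : x != 0 -> exists i, e <= `|(g *m toR V *m toR x) i 0|.
  move=> x0; apply: contrapT => /forallNP h; apply: nshort; exists (V *m x).
    exact: full_rank_mul_neq0 rV x0.
  by move=> i; rewrite map_mxM mulmxA ltW// ltNge; apply/negP/h.
have := wedge_norm_lower j0 rgV e0 long; apply/negP; rewrite -ltNge.
have le1 : n%:R^-1 <= 1 :> R by rewrite invf_le1// ler1n.
have e1 : e <= 1 by rewrite expR_le1 oppr_le0 mulr_ge0 ?divr_ge0// ltW.
apply: (@lt_le_trans _ _ (c * expR (- (beta * tau)))); last first.
  rewrite expr_div_n exprMn exprVn -exprVn.
  rewrite /c -mulrA; apply: ler_pM; rewrite ?mulr_ge0 ?exprn_ge0 ?invr_ge0 ?expR_ge0//.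
  - rewrite /hermite_const; apply: ler_wiXn2l; rewrite ?invr_ge0 ?invf_le1 ?ler1n//.
    by rewrite leq_mul.
  - rewrite mulrC; apply: ler_pM; rewrite ?expR_ge0 ?exprn_ge0 ?invr_ge0//.
    + rewrite /e -!expRM_natl ler_expR.
      have : n%:R * (2 * (beta / (2 * n%:R) * tau)) = beta * tau.
        by field; rewrite gt_eqF.
      have : j%:R * (2 * (beta / (2 * n%:R) * tau)) <= n%:R * (2 * (beta / (2 * n%:R) * tau)).
        by rewrite ler_wpM2r ?ler_nat// !mulr_ge0 ?divr_ge0// ?ltW.
      lra.
    + apply: (@le_trans _ _ ((n%:R^-1 ^+ 2) ^+ j)).
        by apply: ler_wiXn2l; rewrite ?exprn_ge0 ?exprn_ile1 ?invr_ge0.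
      rewrite -exprVn; apply: lerXn2r; rewrite ?nnegrE ?exprn_ge0 ?invr_ge0//.
      apply: lerXn2r; rewrite ?nnegrE ?invr_ge0//.
      by rewrite lef_pV2 ?posrE ?ltr0n// ler_nat.
apply: (@lt_trans _ _ (expR (- (beta * tau)) ^+ 2)).
  by rewrite ltrXn2r ?wedge_norm_ge0// expR_ge0.
by rewrite expr2 ltr_pM2r ?expR_gt0// hT.
Qed.

End small_covolume.

(** * A Borel-Cantelli lemma *)

Section borel_cantelli.
Context {R : realType} {d : nat}.
Local Notation E := 'rV[R]_d.+1.

Lemma sum_geometric_le (q : R) N K : 0 <= q < 1 ->
  \sum_(N <= i < N + K) q ^+ i <= q ^+ N / (1 - q).
Proof.
move=> /andP[q0 q1]; have q1' : 0 < 1 - q by lra.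
suff -> : \sum_(N <= i < N + K) q ^+ i = (q ^+ N - q ^+ (N + K)) / (1 - q).
  by rewrite ler_pM2r ?invr_gt0// gerBl exprn_ge0.
elim: K => [|K ih]; first by rewrite addn0 big_geq// subrr mul0r.
rewrite addnS big_nat_recr ?leq_addr//= ih exprSr.
by field; rewrite gt_eqF.
Qed.

Lemma lebo_limsup0_all (A : nat -> set E) (c a : R) : 0 <= c -> 0 < a ->
  (forall m, (lebo (A m) <= (c * expR (- (a * m%:R)))%:E)%E) ->
  lebo [set x | forall M, exists2 m, (M <= m)%N & A m x] = 0%E.
Proof.
move=> c0 a0 Ac; pose q := expR (- a).
have q01 : 0 <= q < 1 by rewrite expR_ge0 expR_lt1 oppr_lt0.
have qE m : expR (- (a * m%:R)) = q ^+ m by rewrite -expRM_natr mulNr.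
have q1' : 0 < 1 - q by lra.
apply/eqP; rewrite eq_le lebo_ge0 andbT; apply/lee_addgt0Pr => e e0; rewrite add0e.
have c1 : 0 < c + 1 by lra.
have [T T0 hT] := exists_expRN_lt a0 (divr_gt0 (mulr_gt0 e0 q1') c1).
pose N := (Num.truncn T).+1.
have NT : T <= N%:R.
  exact: ltW (truncnS_gt T).
apply: (@le_trans _ _ (lebo (\bigcup_(m in ~` `I_N) A m))).
  apply: le_lebo => x /(_ N)[m Nm Amx]; exists m => //=.
  by apply/negP; rewrite -leqNgt.
apply: le_trans (outer_measure_sigma_subadditive_tail (@lebo R d.+1) N A) _.
apply: (@le_trans _ _ (\sum_(N <= i <oo) (c * q ^+ i)%:E)%E).
  by apply: lee_nneseries => [i _ _|i _]; [exact: lebo_ge0|rewrite -qE; exact: Ac].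
apply: lime_le.
  by apply: is_cvg_nneseries => k _ _; rewrite lee_fin mulr_ge0// exprn_ge0//; case/andP: q01.
near=> K; have NK : (N <= K)%N by near: K; exact: nbhs_infty_ge.
rewrite sumEFin lee_fin -mulr_sumr -(subnKC NK).
apply: (@le_trans _ _ (c * (q ^+ N / (1 - q)))).
  by rewrite ler_wpM2l// sum_geometric_le.
have := hT _ NT; rewrite qE => h.
apply: (@le_trans _ _ ((c + 1) * (q ^+ N / (1 - q)))).
  rewrite ler_wpM2r ?lerDl// divr_ge0 ?exprn_ge0//; last exact: ltW.
  by case/andP: q01.
rewrite mulrA ler_pdivrMr// mulrC -ler_pdivlMr//; exact: ltW.
Unshelve. all: by end_near. Qed.

Lemma lebo_limsup0 (A : nat -> set E) (c a : R) (m0 : nat) : 0 <= c -> 0 < a ->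
  (forall m, (m0 <= m)%N -> (lebo (A m) <= (c * expR (- (a * m%:R)))%:E)%E) ->
  lebo [set x | forall M, exists2 m, (M <= m)%N & A m x] = 0%E.
Proof.
move=> c0 a0 Ac; pose B m := if (m0 <= m)%N then A m else set0.
have B0 : lebo [set x | forall M, exists2 m, (M <= m)%N & B m x] = 0%E.
  apply: (lebo_limsup0_all c0 a0) => m; rewrite /B; case: ifPn => [/Ac//|_].
  by rewrite lebo_set0 lee_fin mulr_ge0 ?expR_ge0.
apply/eqP; rewrite eq_le lebo_ge0 andbT -B0; apply: le_lebo => x hx M.
have [m Mm Amx] := hx (maxn M m0); exists m.
  exact: leq_trans (leq_maxl _ _) Mm.
by rewrite /B (leq_trans (leq_maxr _ _) Mm).
Qed.

(** The n-th power of x <= e^x at x = a (m + 1). It absorbs the number of integral t of sum m. *)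
Lemma natX_le_expR (n m : nat) (a : R) : 0 < a ->
  m.+1%:R ^+ n <= (a^-1 ^+ n * expR (n%:R * a)) * expR (n%:R * a * m%:R).
Proof.
move=> a0; rewrite -mulrA -expRD.
have -> : n%:R * a + n%:R * a * m%:R = n%:R * (a * m.+1%:R) by rewrite -natr1; ring.
rewrite expRM_natl -exprMn; apply: lerXn2r; rewrite ?nnegrE//.
  by rewrite mulr_ge0 ?expR_ge0// invr_ge0 ltW.
rewrite mulrC ler_pdivlMr// mulrC; apply: le_trans (expR_ge1Dx _); lra.
Qed.

End borel_cantelli.

(** * The four conditions *)

Section equivalences.
Context {R : realType} {d n : nat}.
Hypothesis n0 : (0 < n)%N.
Local Notation E := 'rV[R]_d.+1.
Local Notation D := d.+1.
Local Notation toR := (map_mx (@intmul R 1)).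
Variables (U : set E) (f : E -> 'rV[R]_n).
Hypothesis openU : open U.
Hypothesis contf : {within U, continuous f}.

Let short (k m : nat) : set E := [set x | exists t : {ffun 'I_n -> nat},
  (\sum_i t i)%N = m /\ has_short_vector (g_t (\row_i (t i)%:R) *m u_y (f x))
      (expR (- (k.+1%:R^-1 * m%:R)))].

Lemma lebo_VWMA_ball0 (C alpha : R) (V : set E) (c : E) (r : R) :
  0 < C -> 0 < alpha ->
  (forall (c0 : R) (c : 'rV[R]_n),
    CA_good C alpha V (fun x => c0 + \sum_(i < n) c 0 i * f x 0 i)) ->
  V `<=` U -> 0 < r ->
  [set x : E | forall i, `|x 0 i - c 0 i| < (dilation D n)%:R * r] `<=` V ->
  cond_ss f (eball c r) ->
  lebo (eball c r `&` [set x | VWMA (f x)]) = 0%E.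
Proof.
move=> C0 alpha0 goodV VU r0 cV condB.
suff H k : lebo [set x | forall M, exists2 m, (M <= m)%N & (eball c r `&` short k m) x] = 0%E.
  apply/eqP; rewrite eq_le lebo_ge0 andbT -(lebo_null_bigcup_count H).
  apply: le_lebo => x [cx /(short_vectors_of_VWMA n0)[k hk]]; exists k => // M.
  have [t [Mt ht]] := hk M; exists (\sum_i t i)%N => //; split => //.
  by exists t.
pose gam : R := k.+1%:R^-1; have gam0 : 0 < gam by rewrite invr_gt0.
(* Since gam / 8 < gam / 4, the supremum exceeds [rho] = exp(-gam m / 4) strictly and [rho] is
   reached at a point; [eta] / [rho] still decays like exp(-3 gam m / 4). *)
have beta0 : 0 < gam / 8 by rewrite divr_gt0.
have [T [T0 hT]] := condB _ beta0.
have N0 : 0 < 2 * n.+1%:R :> R by rewrite mulr_gt0.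
have N0' : 0 < (2 * n.+1%:R)^-1 :> R by rewrite invr_gt0.
have gam34 : 0 < 3 / 4 * gam by rewrite mulr_gt0.
have [T' T'0 hT'] := exists_expRN_lt gam34 N0'.
pose m0 := (Num.truncn (T + T')).+1.
(* [kap] is the rate of decay for a single t. Half of it, n [dl], pays for the number of t, and the
   other half is left for summation over m. *)
pose kap := 3 / 4 * gam * alpha; have kap0 : 0 < kap by rewrite mulr_gt0.
have nR : 0 < n%:R :> R by rewrite ltr0n.
pose dl := kap / (2 * n%:R); have dl0 : 0 < dl by rewrite divr_gt0// mulr_gt0.
pose c1 : R := (nondiv_const D n)%:R * (C * (2 * n.+1%:R) `^ alpha) * r ^+ D.
have c10 : 0 <= c1 by rewrite !mulr_ge0 ?powR_ge0 ?exprn_ge0// ltW.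
pose c2 := dl^-1 ^+ n * expR (n%:R * dl) * c1.
have c20 : 0 <= c2.
  apply: mulr_ge0 => //; apply: mulr_ge0; rewrite ?expR_ge0//.
  by rewrite exprn_ge0// invr_ge0 ltW.
have kap2 : 0 < kap / 2 by rewrite divr_gt0.
apply: (lebo_limsup0 (m0 := m0) c20 kap2) => m m0m.
have mTT : T + T' < m%:R.
  by apply: lt_le_trans (truncnS_gt _) _; rewrite ler_nat.
pose rho := expR (- (gam / 4 * m%:R)); pose eta := expR (- (gam * m%:R)).
pose eps := 2 * n.+1%:R * eta.
have m_gt0 : 0 < m%:R :> R by lra.
have rho1 : rho <= 1 by rewrite expR_le1 oppr_le0 mulr_ge0// divr_ge0// ltW.
have eps_rho : eps / rho = 2 * n.+1%:R * expR (- (3 / 4 * gam * m%:R)).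
  rewrite /eps -mulrA; congr (_ * _); rewrite /eta /rho -expRN -expRD; congr expR.
  by field.
have le_eps_rho : eps <= rho.
  rewrite -[leRHS]mul1r -ler_pdivrMr ?expR_gt0// eps_rho mulrC -ler_pdivlMr//.
  by rewrite mul1r; apply/ltW/hT'; lra.
(* Entries of a t of sum m are at most m, so these t range over a finite type of (m + 1)^n elements;
   those of another sum get the empty set. *)
pose B (t : {ffun 'I_n -> 'I_m.+1}) : set E := eball c r `&`
  [set x | has_short_vector (g_t (\row_i (t i)%:R) *m u_y (f x)) eta].
pose B' (t : {ffun 'I_n -> 'I_m.+1}) := if (\sum_i t i)%N == m then B t else set0.
have Bt t : (lebo (B' t) <= (c1 * expR (- (kap * m%:R)))%:E)%E.
  rewrite /B'; case: eqP => [tm|_]; last first.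
    by rewrite lebo_set0 lee_fin mulr_ge0 ?expR_ge0.
  have ts : tsum (\row_i (t i)%:R : 'rV[R]_n) = m%:R.
    have := congr1 (fun j => j%:R : R) tm; rewrite /= natr_sum => <-.
    by apply: eq_bigr => i _; rewrite mxE.
  have := @lebo_short_vector_le R d n U f openU contf C alpha V c r eta eps rho
    (\row_i (t i)%:R) (ltW C0) goodV VU r0 cV (expR_gt0 _).
  rewrite eps_rho powRM ?expR_ge0 ?(ltW N0)// -expRM.
  have -> : - (3 / 4 * gam * m%:R) * alpha = - (kap * m%:R) by rewrite /kap; ring.
  have -> : (nondiv_const D n)%:R *
      (C * ((2 * n.+1%:R) `^ alpha * expR (- (kap * m%:R)))) * r ^+ D =
      c1 * expR (- (kap * m%:R)) by rewrite /c1; move: (r ^+ D) => rD; ring.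
  apply => //.
    by rewrite /eps -mulrA ltr_pMl ?ltr1n// mulr_gt0 ?expR_gt0.
  move=> j W LW.
  have t0 i : 0 <= (\row_i (t i)%:R : 'rV[R]_n) 0 i by rewrite mxE.
  have Tt : T <= tsum (\row_i (t i)%:R : 'rV[R]_n) by rewrite ts; lra.
  have := hT _ t0 Tt j W LW; rewrite ts => hsup.
  have : (rho%:E < ereal_sup [set (wedge_norm (g_t (\row_i (t i)%:R) *m u_y (f x) *m
      toR W))%:E | x in eball c r])%E.
    apply: lt_le_trans hsup; rewrite lte_fin ltr_expR ltrN2 ltr_pM2r//; lra.
  by move=> /ereal_sup_gt[_ [z cz <-]]; rewrite lte_fin => /ltW; exists z.
apply: (@le_trans _ _ (lebo (\bigcup_t B' t))).
  apply: le_lebo => x [cx [t [tm ht]]].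
  have tlt i : (t i < m.+1)%N by rewrite ltnS -tm (bigD1 i)//= leq_addr.
  exists [ffun i => Ordinal (tlt i)] => //.
  have E1 : (\sum_i [ffun i => Ordinal (tlt i)] i)%N = m.
    by rewrite -[RHS]tm; apply: eq_bigr => i _; rewrite ffunE.
  rewrite /B' ifT; last by apply/eqP.
  split; first exact: cx.
  have rE : \row_i (t i)%:R = \row_i ([ffun i => Ordinal (tlt i)] i)%:R :> 'rV[R]_n.
    by apply/rowP => i; rewrite !mxE ffunE.
  by rewrite rE in ht; exact: ht.
apply: le_trans (lebo_bigcup_fin _) _.
apply: (@le_trans _ _ (\sum_(t : {ffun 'I_n -> 'I_m.+1})
    (c1 * expR (- (kap * m%:R)))%:E)%E).
  by apply: lee_sum => t _; exact: Bt.
rewrite sumEFin lee_fin sumr_const card_ffun !card_ord -[leLHS]mulr_natr natrX.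
have -> : expR (- (kap / 2 * m%:R)) =
    expR (n%:R * dl * m%:R) * expR (- (kap * m%:R)).
  rewrite -expRD; congr expR; rewrite /dl; field.
  by rewrite gt_eqF.
rewrite [leLHS]mulrC /c2 [leLHS]mulrA.
have -> : dl^-1 ^+ n * expR (n%:R * dl) * c1 *
    (expR (n%:R * dl * m%:R) * expR (- (kap * m%:R))) =
    dl^-1 ^+ n * expR (n%:R * dl) * expR (n%:R * dl * m%:R) * c1 * expR (- (kap * m%:R)).
  by move: (dl^-1 ^+ n) => u; ring.
by rewrite ler_pM2r ?expR_gt0//; apply: ler_wpM2r => //; exact: natX_le_expR.
Qed.

Lemma cond_ss_of_dense : U `<=` closure [set x | U x /\ ~ VWMA (f x)] ->
  forall (c : E) (r : R), 0 < r -> eball c r `<=` U -> cond_ss f (eball c r).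
Proof.
move=> dense c r r0 cU beta beta0; apply: contrapT => /forallNP nT.
have [x [[Ux nV] cx]] := dense c (cU _ (eball_center c r0)) _ (nbhs_eball c r0).
apply: nV.
have [T0 T00 hT0] := @short_vector_of_small_wedge R n beta beta0.
apply: (@VWMA_of_short_vectors R n n0 (f x) (beta / (2 * n%:R))).
  by rewrite divr_gt0// mulr_gt0 ?ltr0n.
move=> T; pose T1 := Num.max (Num.max T T0) 1.
have : ~ forall t : 'rV[R]_n, (forall i, 0 <= t 0 i) -> T1 <= tsum t ->
  forall (j : nat) (V : 'M[int]_(n.+1, j)), lattice_basis R V ->
    ((expR (- (beta * tsum t)))%:E <=
      ereal_sup [set (wedge_norm (g_t t *m u_y (f x) *m
                        map_mx (fun z : int => z%:~R : R) V))%:E | x in eball c r])%E.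
  by move=> h; apply: (nT T1); split => //; rewrite lt_max ltr01 orbT.
move=> /existsNP[t /not_implyP[t0 /not_implyP[Tt /existsNP[j /existsNP[V /not_implyP[LV]]]]]].
move=> /negP; rewrite -ltNge => hsup.
have Tt1 : T <= tsum t by apply: le_trans Tt; rewrite !le_max lexx.
have Tt2 : T0 <= tsum t by apply: le_trans Tt; rewrite !le_max lexx orbT.
exists t; split => //; apply: hT0 LV _ => //.
  by rewrite unitmxE det_mulmx det_g_t det_u_y mulr1 unitr1.
rewrite -lte_fin; apply: le_lt_trans hsup.
by apply: ereal_sup_ubound; exists x.
Qed.

Lemma ae_cond_ss_of_balls :
  (forall (c : E) (r : R), 0 < r -> eball c r `<=` U -> cond_ss f (eball c r)) ->
  ae_in U (fun x0 => forall r : R, 0 < r -> exists r' : R,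
    0 < r' /\ r' < r /\ eball x0 r' `<=` U /\ cond_ss f (eball x0 r')).
Proof.
move=> condB; rewrite /ae_in (_ : [set x | _] = set0) ?lebo_set0// -subset0.
move=> x [Ux]; apply => r r0.
have [r1 r10 hr1] := nbhs_coord (open_nbhs_nbhs (conj openU Ux)).
pose r' := Num.min (r / 2) r1.
have r'0 : 0 < r' by rewrite lt_min r10 divr_gt0.
have r'U : eball x r' `<=` U.
  move=> y xy; apply: hr1 => i; apply: lt_le_trans (eball_coord i xy) _.
  by rewrite ge_min lexx orbT.
exists r'; split => //; split; last by split => //; exact: condB.
by rewrite gt_min; apply/orP; left; lra.
Qed.

(** The balls on which the exceptional set is null are uncountably many. Each is replaced by a
    dyadic cube inside it containing its centre, and the countably many dyadic cubes on which the
    exceptional set is null cover almost all of it. *)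
Lemma strongly_extremal_of_ae : good U f ->
  ae_in U (fun x0 => forall r : R, 0 < r -> exists r' : R,
    0 < r' /\ r' < r /\ eball x0 r' `<=` U /\ cond_ss f (eball x0 r')) ->
  strongly_extremal U f.
Proof.
move=> goodU condU; pose N : set E := [set x | U x /\ VWMA (f x)].
pose Q (kz : nat * 'rV[int]_D) : set E :=
  cube (\row_i ((kz.2 0 i)%:~R / 2 ^+ kz.1)) (1 / 2 ^+ kz.1).
pose NQ kz : set E := if pselect (lebo (N `&` Q kz) = 0%E) then N `&` Q kz else set0.
have NQ0 : lebo (\bigcup_kz NQ kz) = 0%E.
  apply: lebo_null_bigcup_count => kz; rewrite /NQ.
  by case: pselect => //= _; exact: lebo_set0.
have cov : [set x | U x /\ ~ ~ VWMA (f x)] `<=`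
    [set x | U x /\ ~ good_at U f x] `|` ([set x | U x /\ ~ forall r : R, 0 < r ->
      exists r' : R, 0 < r' /\ r' < r /\ eball x r' `<=` U /\ cond_ss f (eball x r')]
      `|` \bigcup_kz NQ kz).
  move=> x [Ux /contrapT Vx].
  have [[V [xV [VU [C [alpha [C0 [alpha0 goodV]]]]]]]|ngood] := pselect (good_at U f x);
    last by left.
  have [condx|ncond] := pselect (forall r : R, 0 < r -> exists r' : R,
    0 < r' /\ r' < r /\ eball x r' `<=` U /\ cond_ss f (eball x r')); last by right; left.
  right; right; have [r0 r00 hr0] := nbhs_coord xV.
  have dil0 : 0 < (dilation D n)%:R :> R.
    by rewrite ltr0n; case: (n) => //= k; rewrite addn1.
  have [r' [r'0 [r'r [r'U condr']]]] := condx _ (divr_gt0 r00 dil0).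
  have null : lebo (eball x r' `&` [set y | VWMA (f y)]) = 0%E.
    apply: lebo_VWMA_ball0 C0 alpha0 goodV VU r'0 _ condr' => y xy; apply: hr0 => i.
    by apply: lt_le_trans (xy i) _; rewrite mulrC -ler_pdivlMr// ltW.
  have [k hk] : exists k, 1 / 2 ^+ k < r' / D%:R.
    by apply: exists_half_lt => //; rewrite divr_gt0.
  have k0 : 0 < 2 ^+ k :> R by rewrite exprn_gt0.
  pose z : 'rV[int]_D := \row_i Num.floor (x 0 i * 2 ^+ k).
  have xQ : Q (k, z) x.
    move=> i; rewrite /= !mxE -mulrDl ler_pdivrMr// ltr_pdivlMr//.
    by have := floor_itv (x 0 i * 2 ^+ k); rewrite intrD.
  exists (k, z) => //; rewrite /NQ; case: pselect => [_|] /=; first by [].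
  case; apply/eqP; rewrite eq_le lebo_ge0 andbT -null; apply: le_lebo => y [[Uy Vy] yQ].
  split => //; have -> : r' = D%:R * (r' / D%:R) by field.
  apply: eball_sup => i; apply: lt_trans hk.
  have := xQ i; have := yQ i; move: (_ 0 i) => a; rewrite ltr_norml; lra.
apply/eqP; rewrite eq_le lebo_ge0 andbT; apply: le_trans (le_lebo cov) _.
apply: le_trans (outer_measureU2 _ _ _) _; rewrite [X in (X + _)%E]goodU add0e.
apply: le_trans (outer_measureU2 _ _ _) _; rewrite [X in (X + _)%E]condU add0e.
by rewrite [X in (X <= _)%E]NQ0.
Qed.

Lemma dense_of_strongly_extremal : strongly_extremal U f ->
  U `<=` closure [set x | U x /\ ~ VWMA (f x)].
Proof.
move=> ext x Ux B xB; apply: contrapT => /set0P/negP/negPn/eqP empty.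
have xUB : nbhs x (U `&` B) by apply: filterI => //; exact: open_nbhs_nbhs.
have [r r0 hr] := nbhs_coord xUB.
apply: (lebo_eball_neq0 (c := x) r0); apply/eqP; rewrite eq_le lebo_ge0 andbT.
rewrite -ext; apply: le_lebo => y xy.
have [Uy By] : (U `&` B) y by apply: hr => i; exact: eball_coord.
split => // nV; have : ([set x | U x /\ ~ VWMA (f x)] `&` B) y by [].
by rewrite empty.
Qed.

End equivalences.

Theorem theorem5p3 (R : realType) (d n : nat) (U : set 'rV[R]_d)
  (f : 'rV[R]_d -> 'rV[R]_n) :
  (0 < d)%N -> (0 < n)%N ->
  open U -> {within U, continuous f} -> good U f ->
  let P1 := U `<=` closure [set x | U x /\ ~ VWMA (f x)] in
  let P2 := strongly_extremal U f in
  let P3 := ae_in U (fun x0 => forall r : R, 0 < r ->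
              exists r' : R, 0 < r' /\ r' < r /\
                eball x0 r' `<=` U /\ cond_ss f (eball x0 r')) in
  let P4 := forall (c : 'rV[R]_d) (r : R), 0 < r -> eball c r `<=` U ->
              cond_ss f (eball c r) in
  (P1 <-> P2) /\ (P2 <-> P3) /\ (P3 <-> P4).
Proof.
case: d U f => // d U f _ n0 openU contf goodf P1 P2 P3 P4.
have h14 : P1 -> P4 := @cond_ss_of_dense R d n n0 U f.
have h43 : P4 -> P3 := @ae_cond_ss_of_balls R d n U f openU.
have h32 : P3 -> P2 := @strongly_extremal_of_ae R d n n0 U f openU contf goodf.
have h21 : P2 -> P1 := @dense_of_strongly_extremal R d n U f openU.
by split; [|split]; split; auto.
Qed.
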